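(* Let $\mathbb{P}_K$ be a Pfaffian point process on $E$ induced by a self-adjoint quaternion kernel $K: E\times E \rightarrow \mathbb{H}_{\mathbb{C}}$, and let $\lambda_1$ be its first correlation measure. Then for $\lambda_1$-almost every $x_0\in E$ we have $K(x_0,x_0)>0$, and the (reduced) Palm measure $\mathbb{P}_K^{x_0}$ of $\mathbb{P}_K$ at $x_0$ coincides with the Pfaffian point process induced by the quaternion kernel $$K^{x_0}(x,y) = \frac{1}{K(x_0,x_0)}\operatorname{Qdet}\begin{bmatrix} K(x,y) & K(x,x_0)\\ K(x_0,y) & K(x_0,x_0)\end{bmatrix} = K(x,y)-\frac{K(x,x_0)K(x_0,y)}{K(x_0,x_0)},\qquad x,y\in E,$$ where the $2\times 2$ matrix is almost self-adjoint with distinguished index $k=1$. In notation, $\mathbb{P}_K^{x_0}=\mathbb{P}_{K^{x_0}}$.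
   Context: **Space.** $E$ is a locally compact $\sigma$-compact Polish space, with a metric for which every bounded set is relatively compact, endowed with a positive $\sigma$-finite Radon measure $\mu$. A configuration on $E$ is a locally finite collection of points of $E$ (multiplicities allowed, order disregarded); $\operatorname{Conf}(E)$ is the set of configurations, identified with the Radon measures $\sum_{x\in X}\delta_x$ and given the Borel sigma-algebra of the vague topology. A point process is a Borel probability measure on $\operatorname{Conf}(E)$; it is simple if almost every configuration has no multiple points. **Correlation functions.** The $k$-point correlation function $\rho_k:E^k\to\mathbb{R}_+$ of $\mathbb{P}$ (if it exists) is determined $\mu^{\otimes k}$-a.e. by $$\int_{A_1^{l_1}\times\cdots\times A_j^{l_j}}\rho_k\,d\mu^{\otimes k}=\int_{\operatorname{Conf}(E)}\prod_{i=1}^j\frac{\#(X\cap A_i)!}{(\#(X\cap A_i)-l_i)!}\,d\mathbb{P}(X)$$ for all bounded disjoint Borel sets $A_1,\dots,A_j$ and positive integers $l_1+\cdots+l_j=k$ (a ratio is $0$ if $\#(X\cap A_i)<l_i$). The $k$-th correlation measure is $d\lambda_k=\rho_k\,d\mu^{\otimes k}$. **Complexified quaternions.** $\mathbb{H}_{\mathbb{C}}$ is the complex algebra of elements $q=q_0+q_1\mathbf{i}+q_2\mathbf{j}+q_3\mathbf{k}$, $q_0,\dots,q_3\in\mathbb{C}$, with $\mathbf{i}^2=\mathbf{j}^2=\mathbf{k}^2=-1$, $\mathbf{i}\mathbf{j}=-\mathbf{j}\mathbf{i}=\mathbf{k}$, $\mathbf{j}\mathbf{k}=-\mathbf{k}\mathbf{j}=\mathbf{i}$,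 $\mathbf{k}\mathbf{i}=-\mathbf{i}\mathbf{k}=\mathbf{j}$, and complex scalars central. The adjoint is $\overline{q}=q_0-q_1\mathbf{i}-q_2\mathbf{j}-q_3\mathbf{k}$ (the complex coefficients are not conjugated); elements with $q=\overline q$ are the scalars and are identified with $\mathbb{C}$. A kernel $K$ is self-adjoint if $K(x,y)=\overline{K(y,x)}$. **Quaternion determinant.** A square matrix $M$ over $\mathbb{H}_{\mathbb{C}}$ is self-adjoint if $M_{ij}=\overline{M_{ji}}$ for all $i,j$; it is almost self-adjoint with distinguished index $k$ if $M_{ij}=\overline{M_{ji}}$ whenever $i\ne k$ and $j\neq k$. For such an $n\times n$ matrix, $\operatorname{Qdet}M=M_{11}$ if $n=1$, and for $n>1$ $$\operatorname{Qdet}M=\sum_{l=1}^n\epsilon_{kl}M_{kl}\operatorname{Qdet}M(k,l),\qquad \epsilon_{kk}=1,\ \epsilon_{kl}=-1\ (l\ne k),$$ where $M(k,l)$ is obtained from $M$ by replacing the $l$-th column by the $k$-th column and then deleting the $k$-th row and $k$-th column (it is self-adjoint if $l=k$, and almost self-adjoint with distinguished index the one corresponding to $l$ if $l\neq k$). For self-adjoint $M$ the value does not depend on $k$ and is in $\mathbb{C}$. **Pfaffian point process.** A point process $\mathbb{P}$ is the Pfaffian point process $\mathbb{P}_K$ induced by (with correlation kernel) a self-adjoint quaternion kernel $K$ if for every $k\ge1$ its $k$-point correlation function exists and equals $\rho_k(x_1,\dots,x_k)=\operatorname{Qdet}[K(x_i,x_j)]_{i,j=1}^k$. Such a process is simple.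 **Palm measures.** For a simple point process $\mathbb{P}$ with $k$-th correlation measure $\lambda_k$, the (reduced) Palm measures $\mathbb{P}^{\mathfrak q}$, defined for $\lambda_k$-a.e. $\mathfrak q=(q_1,\dots,q_k)\in E^k$, are the point processes on $E$ such that for every non-negative Borel $u:\operatorname{Conf}(E)\times E^k\to\mathbb{R}$, $$\int_{\operatorname{Conf}(E)}\sum_{q_1,\dots,q_k\in X}^{*}u(X;\mathfrak q)\,\mathbb{P}(dX)=\int_{E^k}\lambda_k(d\mathfrak q)\int_{\operatorname{Conf}(E)}u(X\cup\{q_1,\dots,q_k\};\mathfrak q)\,\mathbb{P}^{\mathfrak q}(dX),$$ where $\sum^*$ is over mutually distinct points of $X$.
   Formalization: Correlation functions are required to be locally integrable (finite factorial moments on bounded sets); without this the defining identity can read ∞ = ∞, fail to determine ρ_k, and the claim fails, e.g. for a mixed Poisson process with infinite second moment. *)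

(* Defs.v *)
From HB Require Import structures.
From mathcomp Require Import all_boot all_order all_algebra.
From mathcomp Require Import all_classical all_reals all_analysis.
From mathcomp Require Import measurable_realfun.
From mathcomp Require Import ring.
From mathcomp.real_closed Require Import complex.

Set Implicit Arguments.
Unset Strict Implicit.
Unset Printing Implicit Defensive.

Import Order.TTheory GRing.Theory Num.Theory.
Import numFieldNormedType.Exports.

Local Open Scope classical_set_scope.
Local Open Scope ring_scope.

Record quat (C : Type) := Quat { q0 : C; q1 : C; q2 : C; q3 : C }.

Section QuatStructures.

Definition quat_tuple (C : Type) (q : quat C) := (q0 q, q1 q, q2 q, q3 q).
Definition tuple_quat (C : Type) (t : C * C * C * C) :=
  let: (a, b, c, d) := t in Quat a b c d.

Lemma quat_tupleK (C : Type) : cancel (@quat_tuple C) (@tuple_quat C).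
Proof. by case. Qed.

HB.instance Definition _ (C : eqType) :=
  Equality.copy (quat C) (can_type (@quat_tupleK C)).
HB.instance Definition _ (C : choiceType) :=
  Choice.copy (quat C) (can_type (@quat_tupleK C)).

Variable C : comNzRingType.
Implicit Types p q r : quat C.

Definition quat_add p q :=
  Quat (q0 p + q0 q) (q1 p + q1 q) (q2 p + q2 q) (q3 p + q3 q).
Definition quat_opp p := Quat (- q0 p) (- q1 p) (- q2 p) (- q3 p).
Definition quat_scale (a : C) p := Quat (a * q0 p) (a * q1 p) (a * q2 p) (a * q3 p).

(* The Hamilton product, i.e. the C-bilinear product with
   i^2 = j^2 = k^2 = -1, ij = -ji = k, jk = -kj = i, ki = -ik = j. *)
Definition quat_mul p q :=
  Quat (q0 p * q0 q - q1 p * q1 q - q2 p * q2 q - q3 p * q3 q)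
       (q0 p * q1 q + q1 p * q0 q + q2 p * q3 q - q3 p * q2 q)
       (q0 p * q2 q + q2 p * q0 q + q3 p * q1 q - q1 p * q3 q)
       (q0 p * q3 q + q3 p * q0 q + q1 p * q2 q - q2 p * q1 q).

Local Ltac quat_ring := try red; intros;
  repeat match goal with x : quat _ |- _ => destruct x end;
  apply: (f_equal4 (@Quat C)) => /=; ring.

Fact quat_addA : associative quat_add. Proof. quat_ring. Qed.
Fact quat_addC : commutative quat_add. Proof. quat_ring. Qed.
Fact quat_add0 : left_id (Quat 0 0 0 0) quat_add. Proof. quat_ring. Qed.
Fact quat_addN : left_inverse (Quat 0 0 0 0) quat_opp quat_add.
Proof. quat_ring. Qed.

HB.instance Definition _ := GRing.isZmodule.Build (quat C)
  quat_addA quat_addC quat_add0 quat_addN.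

Fact quat_mulA : associative quat_mul. Proof. quat_ring. Qed.
Fact quat_mul1 : left_id (Quat 1 0 0 0) quat_mul. Proof. quat_ring. Qed.
Fact quat_mulr1 : right_id (Quat 1 0 0 0) quat_mul. Proof. quat_ring. Qed.
Fact quat_mulDl : left_distributive quat_mul quat_add. Proof. quat_ring. Qed.
Fact quat_mulDr : right_distributive quat_mul quat_add. Proof. quat_ring. Qed.
Fact quat_1neq0 : Quat (1 : C) 0 0 0 != 0.
Proof. by apply/eqP => -[] /eqP; rewrite oner_eq0. Qed.

HB.instance Definition _ := GRing.Zmodule_isNzRing.Build (quat C)
  quat_mulA quat_mul1 quat_mulr1 quat_mulDl quat_mulDr quat_1neq0.

Fact quat_scaleA a b p : quat_scale a (quat_scale b p) = quat_scale (a * b) p.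
Proof. quat_ring. Qed.
Fact quat_scale1 : left_id 1 quat_scale. Proof. quat_ring. Qed.
Fact quat_scaleDr : right_distributive quat_scale +%R. Proof. quat_ring. Qed.
Fact quat_scaleDl p : {morph quat_scale^~ p : a b / a + b}.
Proof. quat_ring. Qed.

HB.instance Definition _ := GRing.Zmodule_isLmodule.Build C (quat C)
  quat_scaleA quat_scale1 quat_scaleDr quat_scaleDl.

Fact quat_scaleAl (a : C) (p q : quat C) : a *: (p * q) = (a *: p) * q.
Proof. quat_ring. Qed.
HB.instance Definition _ := GRing.Lmodule_isLalgebra.Build C (quat C) quat_scaleAl.

Fact quat_scaleAr (a : C) (p q : quat C) : a *: (p * q) = p * (a *: q).
Proof. quat_ring. Qed.
HB.instance Definition _ := GRing.Lalgebra_isAlgebra.Build C (quat C) quat_scaleAr.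

Definition quat_adj q := Quat (q0 q) (- q1 q) (- q2 q) (- q3 q).

Lemma quat_scalarE (a : C) : a%:A = Quat a 0 0 0 :> quat C.
Proof. by congr Quat => /=; rewrite ?mulr1 ?mulr0. Qed.

Definition almost_selfadjoint_mx n (k : 'I_n) (M : 'M[quat C]_n) :=
  forall i j, i != k -> j != k -> M i j = quat_adj (M j i).

(* M(k, l): column l is overwritten by column k, then row k and column k are
   deleted. *)
Definition qminor n (k l : 'I_n.+1) (M : 'M[quat C]_n.+1) : 'M[quat C]_n :=
  row' k (col' k (\matrix_(i, j) if j == l then M i k else M i j)).

(* qdet k M is Qdet M for M almost self-adjoint with distinguished index k.
   M(k, l) is again almost self-adjoint, with distinguished index the one that
   l gets once k is removed if l != k, and with any distinguished index (ord0
   is chosen here) if l = k. *)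
Fixpoint qdet n : 'I_n.+1 -> 'M[quat C]_n.+1 -> quat C :=
  match n return 'I_n.+1 -> 'M[quat C]_n.+1 -> quat C with
  | 0 => fun k M => M k k
  | n'.+1 => fun k M =>
      \sum_(l < n'.+2) (-1) ^+ (l != k) *
        (M k l * qdet (odflt ord0 (unlift k l)) (qminor k l M))
  end.

End QuatStructures.

HB.mixin Record isBorel (d : measure_display) (R : realType) E
    & Measurable d E & Metric R E := {
  borelE : (measurable : set (set E)) = <<s @open E >>
}.

#[short(type="borelMetricType")]
HB.structure Definition BorelMetric (d : measure_display) (R : realType) :=
  { E of Measurable d E & Metric R E & isBorel d R E }.

Definition metric_bounded (R : realType) (E : metricType R) (B : set E) :=
  exists x r, B `<=` ball x r.

Definition sigma_compact (T : topologicalType) :=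
  exists2 F : (set T)^nat, (forall n, compact (F n)) & \bigcup_n F n = setT.

(* When bounded sets are relatively compact, the metric is automatically
   complete, so completeness may be asked of the given metric itself. *)
Definition polish (R : realType) (E : metricType R) :=
  (exists2 D : set E, countable D & dense D) /\
  (forall F : set_system E, ProperFilter F -> cauchy F -> exists x : E, F --> x).

Definition radon d (R : realType) (E : borelMetricType d R)
    (mu : set E -> \bar R) :=
  (forall F, compact F -> (mu F < +oo)%E) /\
  (forall A, measurable A ->
     mu A = ereal_sup [set mu F | F in [set F | compact F /\ F `<=` A]]).

Section PowerMeasure.
Context d (E : measurableType d) (R : realType).
Variable mu : {sigma_finite_measure set E -> \bar R}.
Local Open Scope ereal_scope.

Definition consp n (p : E * n.-tuple E) : n.+1.-tuple E := [tuple of p.1 :: p.2].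

Lemma measurable_consp n : measurable_fun setT (@consp n).
Proof. exact: measurable_cons. Qed.

Section Step.
Variables (n : nat) (m : {sigma_finite_measure set (n.-tuple E) -> \bar R}).

Definition mpow_step : set (n.+1.-tuple E) -> \bar R :=
  pushforward (mu \x m) (@consp n).


Let mpow_step0 : mpow_step set0 = 0.
Proof. by rewrite /mpow_step /pushforward preimage_set0 measure0. Qed.

Let mpow_step_ge0 A : 0 <= mpow_step A.
Proof. by rewrite /mpow_step /pushforward measure_ge0. Qed.

Let mpow_step_sigma_additive : semi_sigma_additive mpow_step.
Proof.
have mc := @measurable_consp n.
pose c : {mfun _ >-> _} := HB.pack_for {mfun _ >-> _} (@consp n)
  (isMeasurableFun.Build _ _ _ _ (@consp n) mc).
exact: (@measure_semi_sigma_additive _ _ _ (pushforward (mu \x m) c)).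
Qed.

HB.instance Definition _ := isMeasure.Build _ _ _ mpow_step
  mpow_step0 mpow_step_ge0 mpow_step_sigma_additive.

Let mpow_step_sigma_finite : sigma_finite setT mpow_step.
Proof.
have /sigma_finiteP[F [TF ndF Foo]] := sigma_finiteT mu.
have /sigma_finiteP[G [TG ndG Goo]] := sigma_finiteT m.
pose u (x : n.+1.-tuple E) := (thead x, [tuple of behead x] : n.-tuple E).
have cK : cancel (@consp n) u.
  move=> [x y]; congr pair => //=.
  exact/val_inj.
have mu_ : measurable_fun setT u.
  by apply/measurable_fun_pair => /=; [exact: measurable_tnth|
    exact: measurable_behead].
exists (fun k => u @^-1` (F k `*` G k)).
  rewrite -preimage_bigcup (_ : \bigcup_i _ = setT) ?preimage_setT//.
  rewrite -setXTT TF TG predeqE => -[x y]; split.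
    by move=> [k _ []/= ? ?]; split; exists k.
  move=> [/= [k _ Fx] [l _ Gy]]; exists (maxn k l) => //; split.
    by move: x Fx; exact/subsetPset/ndF/leq_maxl.
  by move: y Gy; exact/subsetPset/ndG/leq_maxr.
move=> k; have [mF Fk] := Foo k; have [mG Gk] := Goo k; split.
  rewrite -[X in measurable X]setTI; apply: mu_ => //.
  exact: measurableX.
rewrite /mpow_step /pushforward -comp_preimage (_ : u \o _ = id) ?preimage_id.
  by rewrite product_measure1E// lte_mul_pinfty// ge0_fin_numE.
by apply/funext => x /=; rewrite cK.
Qed.

HB.instance Definition _ := Measure_isSigmaFinite.Build _ _ _ mpow_step
  mpow_step_sigma_finite.

End Step.

Fixpoint mpow (k : nat) : {sigma_finite_measure set (k.-tuple E) -> \bar R} :=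
  match k with
  | 0 => dirac [tuple]
  | n.+1 => mpow_step (mpow n)
  end.

Lemma mpow_boxE k (A : 'I_k -> set E) : (forall i, measurable (A i)) ->
  mpow k [set x | forall i, A i (tnth x i)] = \prod_(i < k) mu (A i).
Proof.
elim: k A => [|k IHk] A mA.
  by rewrite big_ord0 /= diracE mem_set// => -[].
rewrite big_ord_recl -IHk// -product_measure1E//; last first.
  rewrite (_ : mkset _ = \bigcap_i ((@tnth _ E)^~ i @^-1` A (lift ord0 i))).
    apply: fin_bigcap_measurable => // i _.
    by rewrite -[X in measurable X]setTI; exact: measurable_tnth.
  by apply/seteqP; split => [x Ax i _|x Ax i]; apply: Ax.
congr ((_ \x _) _); apply/seteqP; split => -[x y] /=.
  move=> Axy; split; first exact: (Axy ord0).
  by move=> i; have := Axy (lift ord0 i); rewrite tnthS.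
move=> [/= Ax Ay] i; case: (unliftP ord0 i) => [j|] -> //.
by rewrite tnthS; exact: Ay.
Qed.

End PowerMeasure.

Section Configurations.
Context d (R : realType) (E : borelMetricType d R).

(* A configuration is given by the multiplicities of its points. *)
Record conf := Conf {
  mult :> E -> nat;
  conf_locally_finite : forall B, metric_bounded B ->
    finite_set (B `&` [set x | mult x != 0%N])
}.

HB.instance Definition _ := gen_eqMixin conf.
HB.instance Definition _ := gen_choiceMixin conf.

Fact conf0_subproof B : metric_bounded B ->
  finite_set (B `&` [set x | (fun _ : E => 0%N) x != 0%N]).
Proof.
move=> _; rewrite (_ : _ `&` _ = set0)//.
by apply/seteqP; split => x [].
Qed.

HB.instance Definition _ := isPointed.Build conf (Conf conf0_subproof).

Definition conf_count (X : conf) (A : set E) : nat := \sum_(x \in A) mult X x.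

Definition conf_integral (X : conf) (f : E -> R) : R :=
  \sum_(x \in [set: E]) f x *+ mult X x.

Fact conf_add_subproof (X : conf) (k : nat) (q : k.-tuple E) B :
  metric_bounded B ->
  finite_set (B `&` [set x | (X x + count_mem x q)%N != 0%N]).
Proof.
move=> /(conf_locally_finite X) finX.
apply: (@sub_finite_set _ _
  ((B `&` [set x | X x != 0%N]) `|` [set x | x \in tval q])).
  move=> x [Bx]/=; case: (eqVneq (X x) 0%N) => [-> /=|X0 _]; last by left.
  by rewrite add0n -lt0n -has_count has_pred1; right.
by rewrite finite_setU; split => //; exact: finite_seq.
Qed.

(* The union of X and {q_1, ..., q_k}, counted with multiplicity: the sum of the
   associated measures. *)
Definition conf_add (X : conf) (k : nat) (q : k.-tuple E) : conf :=
  Conf (@conf_add_subproof X k q).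

Definition compactly_supported_continuous (f : E -> R) :=
  continuous f /\ compact (closure [set x | f x != 0]).

(* The vague topology, generated by the sets {X | \int f dX \in U} for f
   continuous with compact support and U open. *)
HB.instance Definition _ := @isSubBaseTopological.Build conf
  ((E -> R) * set R)%type
  [set fU | compactly_supported_continuous fU.1 /\ open fU.2]
  (fun fU => [set X | fU.2 (conf_integral X fU.1)]).

HB.instance Definition _ := @isMeasurable.Build
  (sigma_display (@open conf)) conf <<s @open conf >>
  (@sigma_algebra0 _ setT (@open conf)) (@sigma_algebraC _ (@open conf))
  (@sigma_algebra_bigcup _ setT (@open conf)).

End Configurations.

Section PointProcesses.
Context d (R : realType) (E : borelMetricType d R).
Variables (mu : {sigma_finite_measure set E -> \bar R}).
Variable P : probability (conf E) R.

(* A_1^{l_1} x ... x A_j^{l_j}: the i-th coordinate lies in the i-th entry of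
   the list in which each A_a is repeated l_a times. *)
Definition power_box (k j : nat) (A : 'I_j -> set E) (l : 'I_j -> nat) :
    set (k.-tuple E) :=
  [set x | forall i : 'I_k,
     nth set0 (flatten [seq nseq (l a) (A a) | a <- enum 'I_j]) i (tnth x i)].

(* rho is required to be locally integrable, i.e. the moments in the identity
   are finite. Otherwise the identity, which only tests boxes, may read
   +oo = +oo on every non-null box and fails to determine rho almost
   everywhere. *)
Definition correlation_function k (rho : k.-tuple E -> R) :=
  [/\ measurable_fun setT rho,
      (forall x, 0 <= rho x),
      (forall B : set E, measurable B -> metric_bounded B ->
         (mpow mu k).-integrable [set x | forall i, B (tnth x i)] (EFin \o rho)) &
      forall j (A : 'I_j -> set E) (l : 'I_j -> nat),
        (forall a, measurable (A a)) -> (forall a, metric_bounded (A a)) ->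
        trivIset setT A -> (forall a, 0 < l a)%N -> (\sum_(a < j) l a)%N = k ->
        (\int[mpow mu k]_(x in power_box A l) (rho x)%:E =
         \int[P]_X (\prod_(a < j) conf_count X (A a) ^_ l a)%N%:R%:E)%E].

Definition correlation_measure k (rho : k.-tuple E -> R) :
    set (k.-tuple E) -> \bar R :=
  fun A => (\int[mpow mu k]_(x in A) (rho x)%:E)%E.

(* palm is a version of the family of reduced Palm measures; rho is the k-point
   correlation function of P. *)
Definition reduced_palm k (rho : k.-tuple E -> R)
    (palm : k.-tuple E -> probability (conf E) R) :=
  (forall A, measurable A -> measurable_fun setT (fun q => palm q A)) /\
  (forall u : conf E * k.-tuple E -> R,
     measurable_fun setT u -> (forall z, 0 <= u z) ->
     (\int[P]_X (\esum_(q in [set q : k.-tuple E |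
          uniq q /\ forall i, mult X (tnth q i) != 0%N]) (u (X, q))%:E) =
      \int[correlation_measure rho]_q
        \int[palm q]_X (u (conf_add X q, q))%:E)%E).

Definition selfadjoint_kernel (K : E -> E -> quat R[i]) :=
  forall x y, K x y = quat_adj (K y x).

(* The quaternion determinant of a self-adjoint matrix does not depend on the
   row along which it is expanded; it is expanded along the first one. *)
Definition pfaffian_process (K : E -> E -> quat R[i]) :=
  selfadjoint_kernel K /\
  forall k, exists2 rho : k.+1.-tuple E -> R,
    correlation_function rho &
    {ae mpow mu k.+1, forall x,
       ((rho x)%:C)%C%:A =
       qdet ord0 (\matrix_(i, j) K (tnth x i) (tnth x j))}.

End PointProcesses.

Section PalmKernel.
Context (R : realType) (E : Type).
Variables (K : E -> E -> quat R[i]) (x0 : E).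

Definition palm_matrix (x y : E) : 'M[quat R[i]]_2 :=
  \matrix_(i < 2, j < 2)
    K (if i == ord0 then x else x0) (if j == ord0 then y else x0).

(* The division is by the complex number that K(x0, x0) is identified with. *)
Definition palm_kernel (x y : E) : quat R[i] :=
  (q0 (K x0 x0))^-1 *: qdet ord0 (palm_matrix x y).

End PalmKernel.

(* Main.v *)
Require Import Defs.
From HB Require Import structures.
From mathcomp Require Import all_boot all_order all_algebra.
From mathcomp Require Import boolp.
From mathcomp Require Import ring.

Set Implicit Arguments.
Unset Strict Implicit.
Unset Printing Implicit Defensive.

Import Order.TTheory GRing.Theory Num.Theory.

Local Open Scope ring_scope.

(** The proof joins an algebraic fact and a probabilistic one.

    The algebraic fact is the Schur complement identity [qdet_schur]. If
    [K x0 x0] is a nonzero scalar [a], then the quaternion determinant of the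
    matrix [K (x i) (x j) - a^-1 (K (x i) x0) (K x0 (x j))], for
    [1 <= i, j <= k], is [a^-1] times that of [K (x i) (x j)], for
    [0 <= i, j <= k]. The entries do not commute, so the identity is not
    inherited from ordinary determinants. The recursion of [qdet] is rewritten
    as a recursion [bcol], [pminor] on subsets of a fixed index set, which
    expands a minor into signed products of entries along paths. Grouping the
    paths by their first or by their last vertex ([bpath_last]) gives Cramer's
    rule and Sylvester's identity. Sylvester's identity shows that a minor does
    not depend on the row along which it is expanded, up to a factor that is
    cancelled after deforming the matrix to the identity ([minor_indepT]). The
    Schur complement identity follows by induction ([bcol_schur]).

    The probabilistic fact is [palm_correlation_ae]. If [P] is simple, then for
    almost every [q] the reduced Palm measure at [q] has the [k]-point
    correlation function [rho_(k+1) (q, .) / rho_1 q]. With the Schur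
    complement identity and [rho_1 q = K q q], this is the Pfaffian
    formula for the kernel [palm_kernel K q].

    To get the correlation functions of the Palm measure, the Palm formula is
    applied to [u (X, q) = 1_B(q) N_A1(X) ... N_Ak(X)], where [N_A(X)] counts
    the points of [X] in [A] and the sets [B], [A1], ..., [Ak] are disjoint.
    Its left-hand side is then a moment of [P], hence an integral of
    [rho_(k+1)]; comparing densities in [q] gives the identity between moments
    of the Palm measure and integrals of [rho_(k+1) (q, .)], for almost every
    [q] outside the [Ai] ([palm_moment_ae]). The exceptional set depends on
    the sets, so only countably many of them may be tested. They are built
    from a countable base of balls: the first [n] balls cut the space into
    finitely many cells, and one takes the finite intersections of balls cut
    by distinct cells that do not contain [q]. A monotone class argument in
    each coordinate then reaches all Borel sets ([box_identity_ext]), and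
    letting the cells shrink recovers the factorial moments
    ([factorial_moment]).

    Shrinking cells see neither multiple points nor [q] itself. So [P] has to
    be simple, which holds because a [2 x 2] quaternion determinant with two
    equal points vanishes ([cell_simple_ae]); then the Palm measure adds [q] to
    simple configurations only ([palm_simple_ae]), and the correlation measures
    do not charge tuples with a repeated point ([corr_uniq]). *)

(** * Quaternions *)

Section QuatBasics.
Variable C : comNzRingType.
Implicit Types p q : quat C.

Ltac quat_ring := intros;
  repeat match goal with x : quat _ |- _ => destruct x end;
  apply: (f_equal4 (@Quat C)) => /=; ring.

Lemma quat_adjK q : quat_adj (quat_adj q) = q. Proof. quat_ring. Qed.
Lemma quat_adjD p q : quat_adj (p + q) = quat_adj p + quat_adj q.
Proof. quat_ring. Qed.
Lemma quat_adjN p : quat_adj (- p) = - quat_adj p.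
Proof. quat_ring. Qed.
Lemma quat_adjB p q : quat_adj (p - q) = quat_adj p - quat_adj q.
Proof. by rewrite quat_adjD quat_adjN. Qed.
Lemma quat_adjM p q : quat_adj (p * q) = quat_adj q * quat_adj p.
Proof. quat_ring. Qed.
Lemma quat_adjZ a q : quat_adj (a *: q) = a *: quat_adj q.
Proof. quat_ring. Qed.
Lemma quat_adj0 : quat_adj 0 = 0 :> quat C.
Proof. by apply: (f_equal4 (@Quat C)) => //=; rewrite oppr0. Qed.
Lemma quat_adj_sum (J : Type) (r : seq J) (P : pred J) (F : J -> quat C) :
  quat_adj (\sum_(i <- r | P i) F i) = \sum_(i <- r | P i) quat_adj (F i).
Proof. exact: (big_morph _ quat_adjD quat_adj0). Qed.

Lemma quat_mul_adjC q : q * quat_adj q = quat_adj q * q.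
Proof. quat_ring. Qed.

Lemma q0_scalar a : q0 (a%:A : quat C) = a.
Proof. by rewrite quat_scalarE. Qed.

Lemma quat_scalar_inj : injective (fun a : C => a%:A : quat C).
Proof. by move=> a b /(congr1 (@q0 C)); rewrite !q0_scalar. Qed.

Lemma quat_adj_scalar a : quat_adj (a%:A : quat C) = a%:A.
Proof. by rewrite !quat_scalarE /quat_adj /= oppr0. Qed.

End QuatBasics.

Lemma quat_selfadj_scalar (C : idomainType) (q : quat C) : 2%:R != 0 :> C ->
  quat_adj q = q -> q = (q0 q)%:A.
Proof.
move=> C2; case: q => a b c e; rewrite quat_scalarE => -[hb hc he].
have h (x : C) : - x = x -> x = 0.
  move=> /eqP; rewrite eq_sym -subr_eq0 opprK -mulr2n -mulr_natl mulf_eq0.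
  by rewrite (negbTE C2) => /eqP.
by rewrite /= (h b hb) (h c hc) (h e he).
Qed.

Section QuatMap.
Variables (C C' : comNzRingType) (f : {rmorphism C -> C'}).

Definition quat_map (q : quat C) : quat C' :=
  Quat (f (q0 q)) (f (q1 q)) (f (q2 q)) (f (q3 q)).

Fact quat_map_additive : {morph quat_map : x y / x - y}.
Proof.
by move=> x y; apply: (f_equal4 (@Quat C')) => /=; rewrite rmorphB.
Qed.
Fact quat_map_monoid : monoid_morphism quat_map.
Proof.
split=> [|x y].
  by apply: (f_equal4 (@Quat C')) => /=; rewrite ?rmorph1 ?rmorph0.
by apply: (f_equal4 (@Quat C')) => /=; rewrite ?(rmorphB, rmorphD, rmorphM).
Qed.
HB.instance Definition _ :=
  GRing.isZmodMorphism.Build (quat C) (quat C') quat_map quat_map_additive.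
HB.instance Definition _ :=
  GRing.isMonoidMorphism.Build (quat C) (quat C') quat_map quat_map_monoid.

Lemma quat_mapZ a q : quat_map (a *: q) = f a *: quat_map q.
Proof. by apply: (f_equal4 (@Quat C')) => /=; rewrite rmorphM. Qed.

End QuatMap.

(** * Bordered minors of a quaternion matrix *)

Section Bordered.
Variables (C : comNzRingType) (I : finType) (N : I -> I -> quat C).
Implicit Types (S T : {set I}) (r c : I -> quat C).

(** [bcol c l S] is the quaternion determinant of [N] on the indices [l |: S],
    with the column [l] replaced by [c] and with distinguished index [l];
    [pminor S] is the determinant of [N] on [S]. The recursion of [qdet] is
    moved from matrices of decreasing size to decreasing subsets of one index
    type, so that minors of minors need no reindexing. The bound [n] on the
    depth stands for [#|S|]. A minor is expanded at an arbitrary index of [S];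
    for self-adjoint [N], the value is a scalar ([bcol_scalar]) and does not
    depend on this index ([minor_indepT]). *)
Fixpoint bcol_rec (n : nat) c (l : I) S : quat C :=
  if n is n'.+1 then
    (if [pick k in S] is Some k then q0 (bcol_rec n' (N^~ k) k (S :\ k)) else 1)
      *: c l - \sum_(m in S) N l m * bcol_rec n' c m (S :\ m)
  else c l.

Definition bcol c l S := bcol_rec #|S| c l S.

Definition pminor S : C :=
  if [pick k in S] is Some k then q0 (bcol (N^~ k) k (S :\ k)) else 1.

(** Up to sign, the determinant of [N] on [S] bordered by the row [r], the
    column [c] and a zero corner. Expanded, it is the signed sum, over the
    paths [l1, ..., lm] of distinct indices of [S], of [r l1 * N l1 l2 * ... *
    c lm] times the minor of [N] on the indices that are not visited. *)
Definition bpath r c S := \sum_(l in S) r l * bcol c l (S :\ l).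

(** The mirror image of [bcol], with a row in place of the column. *)
Definition brow r l S := pminor S *: r l - bpath r (N^~ l) S.

Lemma bcolE c l S : bcol c l S = pminor S *: c l - bpath (N l) c S.
Proof.
rewrite /bcol /pminor /bpath; case En: #|S| => [|n] /=.
  move/eqP: En; rewrite cards_eq0 => /eqP ->.
  rewrite big_set0 subr0; case: pickP => [k|_]; first by rewrite inE.
  by rewrite scale1r.
have Sn m : m \in S -> #|S :\ m| = n.
  by move=> mS; apply/eqP; rewrite -eqSS -En (cardsD1 m S) mS.
congr (_ *: _ - _).
  by case: pickP => // k kS; rewrite /bcol Sn.
by apply: eq_bigr => m mS; rewrite /bcol Sn.
Qed.

Lemma pminor0 : pminor set0 = 1.
Proof. by rewrite /pminor; case: pickP => // k; rewrite inE. Qed.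

Lemma exchange_setD1 (V : nmodType) S (F : I -> I -> V) :
  \sum_(l in S) \sum_(m in S :\ l) F l m =
  \sum_(m in S) \sum_(l in S :\ m) F l m.
Proof.
rewrite (exchange_big_dep (mem S)) => [|l m _]; last by case/setD1P.
apply: eq_bigr => m /= mS; apply: eq_bigl => l /=.
by rewrite !in_setD1 (mS : m \in S) andbT eq_sym andbC.
Qed.

(** The sum over paths is grouped by the last vertex instead of the first one.
    *)
Lemma bpath_last r c S : bpath r c S = \sum_(l in S) brow r l (S :\ l) * c l.
Proof.
elim: {S}_.+1 {-2}S (ltnSn #|S|) r c => // n IHn S Sn r c.
have S1 l : l \in S -> (#|S :\ l| < n)%N.
  by move=> lS; move: Sn; rewrite (cardsD1 l S) lS.
rewrite /bpath.
under eq_bigr => l lS.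
  rewrite bcolE IHn ?S1// mulrBr mulr_sumr.
  under eq_bigr => m mS do rewrite mulrA.
  over.
rewrite sumrB /= exchange_setD1 -sumrB; apply: eq_bigr => m mS.
rewrite /brow mulrBl -scalerAl -scalerAr; congr (_ - _).
rewrite /bpath mulr_suml; apply: eq_bigr => l lS.
by rewrite bcolE /brow setDDl setUC -setDDl.
Qed.

Section SelfAdjoint.
Hypothesis Nadj : forall i j, N i j = quat_adj (N j i).

Let Nadj_row l : @quat_adj C \o N l = N^~ l.
Proof. by apply/funext => i /=; rewrite [RHS]Nadj. Qed.
Let Nadj_col l : @quat_adj C \o N^~ l = N l.
Proof. by apply/funext => i /=; rewrite [RHS]Nadj. Qed.

(** The adjoint reverses the product along a path; as [N] is self-adjoint,
    this is the product along the reversed path. *)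
Lemma bpath_adj r c S :
  quat_adj (bpath r c S) = bpath (@quat_adj C \o c) (@quat_adj C \o r) S.
Proof.
elim: {S}_.+1 {-2}S (ltnSn #|S|) r c => // n IHn S Sn r c.
have S1 l : l \in S -> (#|S :\ l| < n)%N.
  by move=> lS; move: Sn; rewrite (cardsD1 l S) lS.
rewrite bpath_last quat_adj_sum; apply: eq_bigr => l lS.
rewrite quat_adjM /brow bcolE quat_adjB quat_adjZ IHn ?S1//.
by rewrite Nadj_col.
Qed.

Lemma bcol_adj c l S : quat_adj (bcol c l S) = brow (@quat_adj C \o c) l S.
Proof.
by rewrite bcolE /brow quat_adjB quat_adjZ bpath_adj Nadj_row.
Qed.

Lemma brow_row k l S : brow (N k) l S = bcol (N^~ l) k S.
Proof. by rewrite bcolE. Qed.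

Lemma bcol_adjC k l S : quat_adj (bcol (N^~ l) k S) = bcol (N^~ k) l S.
Proof.
by rewrite bcol_adj Nadj_col brow_row.
Qed.

End SelfAdjoint.
End Bordered.

Lemma bcol_rec_map (C C' : comNzRingType) (f : {rmorphism C -> C'}) (I : finType)
  (N : I -> I -> quat C) n c l S :
  quat_map f (bcol_rec N n c l S) =
  bcol_rec (fun i j => quat_map f (N i j)) n (quat_map f \o c) l S.
Proof.
elim: n c l S => //= n IHn c l S.
rewrite rmorphB /= quat_mapZ rmorph_sum; congr (_ *: _ - _).
  by case: pickP => [k kS|_]; rewrite ?rmorph1// -[LHS]/(q0 (quat_map f _)) IHn.
by apply: eq_bigr => m mS; rewrite rmorphM /= IHn.
Qed.

Section BorderedMap.
Variables (C C' : comNzRingType) (f : {rmorphism C -> C'}) (I : finType).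
Variables (N : I -> I -> quat C).

Lemma bcol_map c l S : quat_map f (bcol N c l S) =
  bcol (fun i j => quat_map f (N i j)) (quat_map f \o c) l S.
Proof. exact: bcol_rec_map. Qed.

Lemma pminor_map S : f (pminor N S) = pminor (fun i j => quat_map f (N i j)) S.
Proof.
rewrite /pminor; case: pickP => [k kS|_]; last by rewrite rmorph1.
by rewrite -[LHS]/(q0 (quat_map f _)) bcol_map.
Qed.
End BorderedMap.

Lemma pminor_id (C : comNzRingType) (I : finType) (S : {set I}) :
  pminor (fun i j : I => (i == j)%:R : quat C) S = 1.
Proof.
elim: {S}_.+1 {-2}S (ltnSn #|S|) => // n IHn S Sn.
rewrite /pminor; case: pickP => // k kS.
rewrite bcolE IHn; last by move: Sn; rewrite (cardsD1 k S) kS.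
rewrite eqxx scale1r /bpath big1 ?subr0// => l.
by rewrite in_setD1 => /andP[/negbTE lk _]; rewrite eq_sym lk mul0r.
Qed.

(** * Cramer, Sylvester, and independence of the expansion row *)

Section Independence.
Variables (C : idomainType) (I : finType) (N : I -> I -> quat C).
Hypothesis C2 : 2%:R != 0 :> C.
Hypothesis Nadj : forall i j, N i j = quat_adj (N j i).
Implicit Types (S T R : {set I}) (r c : I -> quat C).

Lemma bcol_scalar k S : bcol N (N^~ k) k S = (q0 (bcol N (N^~ k) k S))%:A.
Proof. by apply: quat_selfadj_scalar => //; exact: bcol_adjC. Qed.

Definition minor_indep S :=
  forall k, k \in S -> bcol N (N^~ k) k (S :\ k) = (pminor N S)%:A.

(** Cramer's rule. Grouped by the last vertex, the paths that end at [k] give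
    the expansion of the minor of [T] at [k]. The others give, for each last
    vertex [m], the rule on [T :\ m], so they cancel against the minor of [T
    :\ m]. *)
Lemma cramer_row T : (forall S, S \subset T -> minor_indep S) ->
  forall k c, k \in T -> bpath N (N k) c T = pminor N T *: c k.
Proof.
elim: {T}_.+1 {-2}T (ltnSn #|T|) => // n IHn T Tn ind k c kT.
rewrite bpath_last (bigD1 k)//= brow_row ind// -scalerAl mul1r.
rewrite big1 ?addr0// => m /andP[mT mk].
rewrite /brow IHn ?subrr ?mul0r//.
- by move: Tn; rewrite (cardsD1 m T) mT.
- by move=> S ST; apply: ind; exact: subset_trans ST (subD1set _ _).
- by rewrite in_setD1 eq_sym mk.
Qed.

Lemma cramer_col T : (forall S, S \subset T -> minor_indep S) ->
  forall k r, k \in T -> bpath N r (N^~ k) T = pminor N T *: r k.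
Proof.
move=> ind k r kT; apply: (can_inj (@quat_adjK C)).
rewrite bpath_adj// quat_adjZ -(cramer_row ind (@quat_adj C \o r) kT)//.
by congr bpath; apply/funext => i /=; rewrite [RHS]Nadj.
Qed.

(** Sylvester's identity for non-commuting entries. By Cramer's rule for rows,
    the [w m] solve a linear system with matrix [N]. By Cramer's rule for
    columns, the rows of [N] on [R], combined with the coefficients [brow N r
    k (R :\ k)], give the row [pminor N R *: r]. The same combination of the
    equations of the system computes the scalar product of [r] and [w]. *)
Lemma sylvester R j : j \notin R -> (forall S, S \subset j |: R -> minor_indep S) ->
  forall r c, pminor N R *: bpath N r c (j |: R) =
   pminor N (j |: R) *: bpath N r c R + brow N r j R * bcol N c j R.
Proof.
move=> jR ind r c.
have jT : j \in j |: R by rewrite setU11.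
pose w m := bcol N c m ((j |: R) :\ m).
have wj : w j = bcol N c j R by rewrite /w setU1K.
have cram k : k \in R -> \sum_(m in R) N k m * w m =
    pminor N (j |: R) *: c k - N k j * w j.
  move=> kR; rewrite -(cramer_row ind c (_ : k \in j |: R)) ?setU1r//.
  by rewrite /bpath big_setU1//= addrC addrK.
have indR S : S \subset R -> minor_indep S.
  by move=> SR; apply: ind; exact: subset_trans SR (subsetUr _ _).
have E : pminor N R *: \sum_(m in R) r m * w m =
    pminor N (j |: R) *: bpath N r c R - bpath N r (N^~ j) R * w j.
  rewrite scaler_sumr.
  under eq_bigr => m mR.
    rewrite scalerAl -(cramer_col indR r mR) bpath_last mulr_suml.
    under eq_bigr => k kR do rewrite -mulrA.
    over.
  rewrite exchange_big /=.
  under eq_bigr => k kR do rewrite -mulr_sumr cram// mulrBr -scalerAr mulrA.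
  by rewrite sumrB -scaler_sumr -mulr_suml -!bpath_last.
rewrite {1}/bpath big_setU1//= scalerDr E -/(w j) wj /brow mulrBl scalerAl.
by rewrite addrCA addrA.
Qed.

(** By Sylvester's identity, the expansions of the minor of [S] at [k] and at
    [j], multiplied by the minor of [S :\ k :\ j], are the product of the
    minors of [S :\ k] and [S :\ j], minus [quat_adj q * q] and [q * quat_adj
    q] for the same [q]. These two norms agree, and the common factor is
    cancelled. *)
Lemma minor_indep_gen : (forall S, pminor N S != 0) -> forall S, minor_indep S.
Proof.
move=> nz S; elim: {S}_.+1 {-2}S (ltnSn #|S|) => // n IHn S Sn.
have E j k : j \in S -> k \in S -> j != k ->
    pminor N (S :\ k :\ j) *: bcol N (N^~ k) k (S :\ k) =
    (pminor N (S :\ k) * pminor N (S :\ j))%:A -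
    quat_adj (bcol N (N^~ k) j (S :\ k :\ j)) * bcol N (N^~ k) j (S :\ k :\ j).
  move=> jS kS jk; set R := S :\ k :\ j.
  have jSk : j \in S :\ k by rewrite in_setD1 jk.
  have kSj : k \in S :\ j by rewrite in_setD1 eq_sym jk.
  have SkE : S :\ k = j |: R by rewrite setD1K.
  have RE : R = S :\ j :\ k by rewrite /R setDDl setUC -setDDl.
  have SjE : S :\ j = k |: R by rewrite RE setD1K.
  have kR : k \notin R by rewrite !inE eqxx andbF.
  have IHk T : T \subset S :\ k -> minor_indep T.
    move=> Tk; apply: IHn; apply: leq_ltn_trans (subset_leq_card Tk) _.
    by move: Sn; rewrite (cardsD1 k S) kS.
  rewrite bcolE scalerBr [in X in _ *: bpath _ _ _ X]SkE.
  rewrite sylvester ?inE ?eqxx//; last by rewrite -SkE.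
  rewrite -SkE brow_row (bcol_adjC Nadj) opprD addrA; congr (_ - _).
  have : bcol N (N^~ k) k R = (pminor N (S :\ j))%:A.
    rewrite -(setU1K kR) -SjE; apply: IHn => //.
    by move: Sn; rewrite (cardsD1 j S) jS.
  rewrite bcolE => {}E.
  by rewrite -[RHS]scalerA -E scalerBr !scalerA (mulrC (pminor N R)).
move=> k kS; rewrite bcol_scalar; congr _%:A.
rewrite /pminor; case: pickP => [j jS|]; last by move/(_ k); rewrite kS.
case: (eqVneq j k) => [->//|jk].
have := E k j kS jS; rewrite eq_sym jk => /(_ isT).
have -> : S :\ j :\ k = S :\ k :\ j by rewrite !setDDl setUC.
rewrite -(bcol_adjC Nadj j k) quat_adjK quat_mul_adjC (mulrC (pminor N (S :\ j))) => Ej.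
have Ek := E j k jS kS jk.
have := etrans Ek (esym Ej).
rewrite [bcol _ _ k _]bcol_scalar [bcol _ _ j _ in RHS]bcol_scalar.
rewrite !scalerA => /quat_scalar_inj /(mulfI (nz _)) <-.
by rewrite q0_scalar.
Qed.

End Independence.

Section Deformation.
Variables (C : idomainType) (I : finType) (N : I -> I -> quat C).
Hypothesis C2 : 2%:R != 0 :> C.
Hypothesis Nadj : forall i j, N i j = quat_adj (N j i).

(** The deformation [(1 - X) 1 + X N] specializes at 0 to the identity, so
    that none of its minors vanishes, and at 1 to [N]. *)
Let Nt i j : quat {poly C} :=
  (1 - 'X) *: (i == j)%:R + 'X *: quat_map polyC (N i j).

Let Nt_eval x i j : quat_map (horner_eval x) (Nt i j) =
  (1 - x) *: (i == j)%:R + x *: N i j.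
Proof.
rewrite rmorphD /= !quat_mapZ rmorph_nat /= /horner_eval hornerD hornerN hornerX hornerC.
congr (_ + _ *: _); case: (N i j) => a b c e.
by rewrite /quat_map /= /horner_eval !hornerC.
Qed.

Let Nt_adj i j : Nt i j = quat_adj (Nt j i).
Proof.
rewrite quat_adjD !quat_adjZ eq_sym; congr (_ *: _ + _ *: _).
  by case: eqP => _; rewrite ?quat_adj0//= -[1]scale1r quat_adj_scalar.
by rewrite Nadj /quat_map /quat_adj /= !polyCN.
Qed.

Lemma minor_indepT S : minor_indep N S.
Proof.
have N1 : (fun i j => quat_map (horner_eval 1) (Nt i j)) = N.
  by apply/funext => i; apply/funext => j; rewrite Nt_eval subrr scale0r add0r scale1r.
have N0 : (fun i j => quat_map (horner_eval 0) (Nt i j)) = (fun i j => (i == j)%:R).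
  apply/funext => i; apply/funext => j.
  by rewrite Nt_eval subr0 scale1r scale0r addr0.
have P2 : 2%:R != 0 :> {poly C} by rewrite -polyC_natr polyC_eq0.
have nz T : pminor Nt T != 0.
  apply/eqP => /(congr1 (horner_eval 0)); rewrite pminor_map N0 pminor_id.
  by rewrite rmorph0 => /eqP; rewrite oner_eq0.
move=> k kS.
have := congr1 (quat_map (horner_eval 1)) (minor_indep_gen P2 Nt_adj nz kS).
rewrite bcol_map quat_mapZ rmorph1 pminor_map N1 => <-; congr bcol.
by apply/funext => i /=; rewrite Nt_eval subrr scale0r add0r scale1r.
Qed.

End Deformation.

(** * The quaternion determinant and Schur complements *)

Section QdetMatch.
Variables (C : idomainType) (I : finType) (N : I -> I -> quat C).
Hypothesis C2 : 2%:R != 0 :> C.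
Hypothesis Nadj : forall i j, N i j = quat_adj (N j i).

(** Both sides obey the same recursion: [qminor k l A] is again of this form,
    with the same column [c] if [l != k]. If [l = k] it is an ordinary minor
    of [N], expanded by [qdet] at its first index, and [minor_indepT] is what
    identifies it with [pminor]. *)
Lemma qdet_bcol n (k : 'I_n.+1) (A : 'M[quat C]_n.+1) (e : 'I_n.+1 -> I) c :
  injective e ->
  (forall i j, j != k -> A i j = N (e i) (e j)) -> (forall i, A i k = c (e i)) ->
  qdet k A = bcol N c (e k) [set e (lift k i) | i in [set: 'I_n]].
Proof.
elim: n k A e c => [|n IHn] k A e c einj AN Ac.
  rewrite /= Ac (_ : [set _ | _ in _] = set0); last first.
    by apply/setP => x; rewrite inE; apply/imsetP => -[[]].
  by rewrite bcolE pminor0 scale1r /bpath big_set0 subr0.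
have linj : injective (e \o lift k) by move=> i j /einj /lift_inj.
set S := [set _ | _ in _].
have Sl (l : 'I_n.+1) : S :\ e (lift k l) =
    [set e (lift k (lift l i)) | i in [set: 'I_n]].
  apply/setP => x; rewrite in_setD1; apply/andP/imsetP.
    move=> [xl /imsetP[i _ xi]]; move: xl; rewrite xi => il.
    case: (unliftP l i) il => [j ->|->]; last by rewrite eqxx.
    by move=> _; exists j.
  move=> [i _ ->]; split; first by rewrite (inj_eq linj) eq_sym neq_lift.
  by apply: imset_f; rewrite inE.
have mE l i j : qminor k l A i j =
    if lift k j == l then A (lift k i) k else A (lift k i) (lift k j).
  by rewrite !mxE.
rewrite [LHS]/= (bigD1_ord k)//= eqxx expr0 mul1r unlift_none /=.
rewrite bcolE Ac; congr (_ + _).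
  pose c' := N^~ (e (lift k ord0)).
  rewrite (IHn ord0 _ (e \o lift k) c' linj).
  - rewrite /= -(Sl ord0) /c' (minor_indepT C2 Nadj); last first.
      by apply: imset_f; rewrite inE.
    by rewrite mulr_algr.
  - move=> i j j0; rewrite mE [lift k j == k]eq_sym (negbTE (neq_lift _ _)).
    by rewrite AN//= eq_sym neq_lift.
  - move=> i; rewrite mE [lift k _ == k]eq_sym (negbTE (neq_lift _ _)).
    by rewrite AN//= eq_sym neq_lift.
rewrite /bpath big_imset/=; last by move=> i j _ _; exact: linj.
rewrite -sumrN.
apply: eq_big => [l|l _]; first by rewrite inE.
rewrite [lift k l == k]eq_sym (negbTE (neq_lift _ _)) expr1 mulN1r.
rewrite liftK /= AN 1?eq_sym ?neq_lift//; congr (- (_ * _)).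
rewrite (IHn l _ (e \o lift k) c linj) ?Sl//.
- move=> i j jl; rewrite mE (inj_eq (@lift_inj _ k)) (negbTE jl) AN//.
  by rewrite eq_sym neq_lift.
- by move=> i; rewrite mE eqxx Ac.
Qed.

Lemma qdet_pminor n (e : 'I_n.+1 -> I) : injective e ->
  qdet ord0 (\matrix_(i, j) N (e i) (e j)) =
  (pminor N [set e i | i in [set: 'I_n.+1]])%:A.
Proof.
move=> einj; rewrite (qdet_bcol (e := e) (c := N^~ (e ord0)))//; last 2 first.
- by move=> i j _; rewrite mxE.
- by move=> i; rewrite mxE.
rewrite -(minor_indepT C2 Nadj (k := e ord0)); last by apply: imset_f; rewrite inE.
congr bcol; apply/setP => x; rewrite in_setD1; apply/imsetP/andP.
  move=> [i _ ->]; rewrite (inj_eq einj) eq_sym neq_lift; split => //.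
  by apply: imset_f; rewrite inE.
move=> [x0 /imsetP[i _ xi]]; move: x0; rewrite xi.
by case: (unliftP ord0 i) => [j ->|->]; rewrite ?eqxx// => _; exists j.
Qed.

End QdetMatch.

Section Schur.
Variables (C : fieldType) (I : finType) (N : I -> I -> quat C) (o : I) (a : C).
Hypothesis C2 : 2%:R != 0 :> C.
Hypothesis Nadj : forall i j, N i j = quat_adj (N j i).
Hypothesis Noo : N o o = a%:A.
Hypothesis a0 : a != 0.

Definition schur i j := N i j - a^-1 *: (N i o * N o j).

(** Eliminating [o] divides minors by [a]. Along the recursion of [bcol], the
    rank one corrections of [schur] add up to the sum that Cramer's rule for
    the row [o] evaluates. *)
Lemma bcol_schur n : forall T : {set I}, (#|T| < n)%N -> o \notin T ->
  pminor schur T = a^-1 * pminor N (o |: T) /\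
  forall (c : I -> quat C) l, l \notin o |: T ->
   bcol schur (fun i => c i - a^-1 *: (N i o * c o)) l T =
   a^-1 *: bcol N c l (o |: T).
Proof.
elim: n => // n IHn T Tn oT.
have oTm m : m \in T -> m != o.
  by move=> mT; apply: contraNneq oT => <-.
have Tm m : m \in T -> (#|T :\ m| < n)%N /\ o \notin T :\ m.
  move=> mT; rewrite in_setD1 (negbTE oT) andbF; split=> //.
  by move: Tn; rewrite (cardsD1 m T) mT.
have oTD m : m \in T -> (o |: T) :\ m = o |: (T :\ m).
  move=> mT; rewrite setDUl; congr (_ :|: _); apply/setDidPl.
  by rewrite disjoints1 inE eq_sym oTm.
have mTm m : m \in T -> m \notin o |: (T :\ m).
  by move=> mT; rewrite !inE eqxx orbF oTm.
have E1 : pminor schur T = a^-1 * pminor N (o |: T).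
  rewrite [LHS]/pminor; case: pickP => [k kT|T0].
    have [_ ->//] := IHn _ (Tm k kT).1 (Tm k kT).2; last exact: mTm.
    rewrite -oTD// (minor_indepT C2 Nadj) ?setU1r//.
    by rewrite scalerA q0_scalar.
  have -> : T = set0 by apply/setP => x; rewrite inE; exact: T0.
  rewrite setU0; have := minor_indepT C2 Nadj (set11 o).
  rewrite setDv bcolE pminor0 scale1r /bpath big_set0 subr0 Noo.
  by move=> /quat_scalar_inj <-; rewrite mulVf.
split=> // c l loT.
have cram := cramer_row (fun S _ => @minor_indepT _ _ _ C2 Nadj S) c (setU11 o T).
rewrite bcolE E1 bcolE {2}/bpath big_setU1//= /bpath setU1K//.
move: cram; rewrite /bpath big_setU1//= setU1K// Noo => cram.
under [in LHS]eq_bigr => m mT.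
  have [_ ->//] := IHn _ (Tm m mT).1 (Tm m mT).2; last exact: mTm.
  rewrite -oTD// -scalerAr /schur mulrBl scalerBr -scalerAl -mulrA.
  over.
rewrite sumrB -!scaler_sumr -mulr_sumr.
set X := \sum_(m in T) N o m * _ in cram *; set Y := \sum_(m in T) _.
have -> : X = pminor N (o |: T) *: c o - a *: bcol N c o T.
  by rewrite -cram mulr_algl addrAC subrr add0r.
rewrite mulrBr -!scalerAr !scalerBr !scalerA opprB.
rewrite (mulrAC _ (pminor _ _)) mulfVK// addrA subrKA scalerDr.
by rewrite opprD addrA.
Qed.

Lemma schur_adj i j : schur i j = quat_adj (schur j i).
Proof.
by rewrite /schur quat_adjB quat_adjZ quat_adjM -!Nadj.
Qed.

Lemma pminor_schur (T : {set I}) : o \notin T ->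
  pminor schur T = a^-1 * pminor N (o |: T).
Proof. by move=> oT; have [] := bcol_schur (ltnSn #|T|) oT. Qed.

End Schur.

(** The determinants of [K] at [x0, ..., xk], divided by [K x0 x0], are those
    of the kernel obtained by eliminating [x0]. *)
Lemma qdet_schur (C : fieldType) (X : Type) (K : X -> X -> quat C) n
    (x : 'I_n.+2 -> X) (a : C) : 2%:R != 0 :> C ->
  (forall i j, K i j = quat_adj (K j i)) ->
  K (x ord0) (x ord0) = a%:A -> a != 0 ->
  qdet ord0 (\matrix_(i < n.+1, j < n.+1)
    (K (x (lift ord0 i)) (x (lift ord0 j)) -
     a^-1 *: (K (x (lift ord0 i)) (x ord0) * K (x ord0) (x (lift ord0 j))))) =
  a^-1 *: qdet ord0 (\matrix_(i < n.+2, j < n.+2) K (x i) (x j)).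
Proof.
move=> C2 Kadj Ka a0; pose N (i j : 'I_n.+2) := K (x i) (x j).
have Nadj i j : N i j = quat_adj (N j i) by exact: Kadj.
rewrite -[X in qdet _ X]/(\matrix_(i, j)
  schur N ord0 a (lift ord0 i) (lift ord0 j)).
rewrite (qdet_pminor C2 (schur_adj ord0 a Nadj) (@lift_inj _ ord0)).
rewrite (qdet_pminor C2 Nadj (e := id))// (pminor_schur C2 Nadj Ka)//.
  rewrite scalerA; congr (_ * pminor _ _)%:A; apply/setP => i; rewrite !inE.
  rewrite imset_id inE; case: (unliftP ord0 i) => [j ->|->//].
  by rewrite imset_f ?orbT// inE.
by apply/imsetP => -[i _]; apply/eqP; exact: neq_lift.
Qed.

From mathcomp Require Import all_classical all_reals all_analysis.
From mathcomp Require Import measurable_realfun.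
From mathcomp.real_closed Require Import complex.
From mathcomp Require Import lra.

Import numFieldNormedType.Exports.

Local Open Scope classical_set_scope.

(** * A countable base of balls and its cells *)

Section BallBase.
Context d (R : realType) (E : borelMetricType d R).

Definition ball_base (c : nat -> E) (r : nat -> R) :=
  forall x (O : set E), open O -> O x ->
    exists k, ball (c k) (r k) x /\ ball (c k) (r k) `<=` O.

Lemma open_mball (x : E) (r : R) : open (ball x r).
Proof.
rewrite openE => y; rewrite ballEmdist /= => xy.
apply/nbhs_ballP; exists (r - mdist x y) => /=; first by rewrite subr_gt0.
move=> z; rewrite !ballEmdist /= ltrBrDl => yz.
exact: le_lt_trans (metric_triangle _ _ _) yz.
Qed.

Lemma measurable_open (O : set E) : open O -> measurable O.
Proof. by move=> oO; rewrite borelE; exact: sub_sigma_algebra. Qed.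

Lemma measurable_mball (x : E) (r : R) : measurable (ball x r).
Proof. exact/measurable_open/open_mball. Qed.

Lemma bounded_mball (x : E) (r : R) : metric_bounded (ball x r).
Proof. by exists x, r. Qed.

Lemma metric_bounded_sub (A B : set E) : A `<=` B -> metric_bounded B -> metric_bounded A.
Proof. by move=> AB [x [r Br]]; exists x, r; exact: subset_trans Br. Qed.

Lemma bounded_center (x0 : E) (A : set E) : metric_bounded A ->
  exists m : nat, A `<=` ball x0 m%:R.
Proof.
move=> [x [r Ar]]; exists (Num.truncn (mdist x0 x + r)).+1 => y /Ar.
rewrite !ballEmdist /= => xy; apply: le_lt_trans (metric_triangle _ x _) _.
by apply: lt_trans (truncnS_gt _); rewrite ltrD2l.
Qed.

Lemma mball_nat_mono (x0 : E) (m n : nat) : (m <= n)%N ->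
  ball x0 (m%:R : R) `<=` ball x0 (n%:R : R).
Proof.
move=> mn y; rewrite !ballEmdist /= => /lt_le_trans; apply.
by rewrite ler_nat.
Qed.

Lemma mball_nat_cover (x0 y : E) : exists m : nat, ball x0 (m%:R : R) y.
Proof.
exists (Num.truncn (mdist x0 y)).+1; rewrite ballEmdist /=; exact: Num.Theory.truncnS_gt.
Qed.

(** Balls of radius [1 / m.+1] around the points of a countable dense set. *)
Lemma ex_ball_base (x0 : E) : polish E -> exists c r, ball_base c r.
Proof.
move=> [[D cD dD] _].
have D0 : D !=set0.
  have [|x [_ Dx]] := dD setT _ openT; first by exists x0.
  by exists x.
have [e eD] : exists e : nat -> E, D `<=` range e.
  have /pfcard_geP[D00|[e]] := cD; first by rewrite D00 in D0; case: D0.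
  by exists e => x Dx; have [n _ <-] := @surj _ _ _ _ e x Dx; exists n.
pose dec (k : nat) : nat * nat := odflt (0%N, 0%N) (unpickle k).
exists (fun k => e (dec k).1), (fun k => (dec k).2.+1%:R^-1) => x O oO Ox.
have /nbhs_ballP[eps /= eps0 epsO] : nbhs x O by exact: open_nbhs_nbhs.
have [m meps] : exists m : nat, m.+1%:R^-1 < eps / 2.
  exists (Num.truncn (eps / 2)^-1).
  by rewrite invf_plt ?posrE ?divr_gt0// Num.Theory.truncnS_gt.
have m0 : 0 < m.+1%:R^-1 :> R by rewrite invr_gt0.
have [y [xy Dy]] := dD (ball x m.+1%:R^-1)
  (ex_intro _ x (ballxx x m0)) (open_mball x m.+1%:R^-1).
have [a _ eay] := eD y Dy.
exists (pickle (a, m)); rewrite /dec pickleK /= eay; split.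
  exact: ball_sym.
move=> z yz; apply: epsO; have := ball_triangle xy yz; apply: le_ball.
by rewrite (splitr eps) ltW// ltrD.
Qed.

Section WithBase.
Variables (c : nat -> E) (r : nat -> R).
Hypothesis cr : ball_base c r.

Definition bball k : set E := ball (c k) (r k).

Lemma bball_separated x y : x != y -> exists k, bball k x /\ ~ bball k y.
Proof.
rewrite -mdist_gt0 => xy.
have [k [kx kxy]] := cr (open_mball x (mdist x y)) (ballxx x xy).
exists k; split => // /kxy.
by rewrite ballEmdist /= ltxx.
Qed.

(** The finite intersections of base balls form a countable pi-system that
    generates the Borel sets ([base_interE]): identities that hold almost
    everywhere for each fixed set can be tested on it simultaneously. *)
Definition base_inter (s : seq nat) : set E := [set x | forall k, k \in s -> bball k x].

Definition base_inters : set (set E) := range base_inter.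

Lemma base_inter_cat s t : base_inter (s ++ t) = base_inter s `&` base_inter t.
Proof.
apply/seteqP; split => [x st|x [sx tx] k].
  by split=> k ks; apply: st; rewrite mem_cat ks ?orbT.
by rewrite mem_cat => /orP[/sx|/tx].
Qed.

Lemma setI_closed_base_inters : setI_closed base_inters.
Proof. by move=> _ _ [s _ <-] [t _ <-]; exists (s ++ t) => //; rewrite base_inter_cat. Qed.

Lemma base_inter_nil : base_inter [::] = setT.
Proof. by apply/seteqP; split. Qed.

Lemma measurable_base_inter s : measurable (base_inter s).
Proof.
elim: s => [|k s IHs]; first by rewrite base_inter_nil.
rewrite -cat1s base_inter_cat; apply: measurableI => //.
rewrite (_ : base_inter _ = bball k); first exact: measurable_mball.
by apply/seteqP; split => [x /(_ k)|x kx j]; rewrite inE ?eqxx//; [exact|move=> /eqP ->].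
Qed.

Lemma base_interE : (measurable : set (set E)) = <<s base_inters >>.
Proof.
apply/seteqP; split; last first.
  apply: smallest_sub => [|_ [s _ <-]]; last exact: measurable_base_inter.
  exact: sigma_algebra_measurable.
rewrite borelE; apply: smallest_sub; first exact: smallest_sigma_algebra.
move=> O oO.
have -> : O = \bigcup_(k in [set k | bball k `<=` O]) base_inter [:: k].
  apply/seteqP; split => [x Ox|x [k kO]].
    have [k [kx kO]] := cr oO Ox; exists k => // j.
    by rewrite inE => /eqP ->.
  by move=> /(_ k); rewrite inE eqxx => /(_ isT)/kO.
rewrite bigcup_mkcond; apply: sigma_algebra_bigcup => k.
case: ifPn => _; last exact: sigma_algebra0.
by apply: sub_sigma_algebra; exists [:: k].
Qed.

(** The code of [x] at level [n] records which of the first [n] base balls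
    contain [x]. Points with the same code form a cell; the cells of a level
    are finitely many, they refine those of the lower levels ([code_le]), and
    they finally separate any two points ([code_sep]). *)
Definition ball_code n (x : E) : n.-tuple bool := [tuple x \in bball k | k < n].

Definition ball_cell n (b : n.-tuple bool) : set E := [set x | ball_code n x = b].

Lemma measurable_cell n (b : n.-tuple bool) : measurable (ball_cell b).
Proof.
rewrite (_ : ball_cell b = \bigcap_(k in [set: 'I_n])
    (if tnth b k then bball k else ~` bball k)).
  apply: fin_bigcap_measurable => // k _.
  by case: ifP => _; [|apply: measurableC]; exact: measurable_mball.
apply/seteqP; split => [x <- k _|x xb].
  by rewrite tnth_mktuple; case: ifPn => [|/negP]; rewrite inE.
apply: eq_from_tnth => k; rewrite tnth_mktuple; have := xb k I.
case: ifP => _ kx; first by rewrite mem_set.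
by apply/negbTE; rewrite notin_setE.
Qed.

Lemma code_le m n x y : (m <= n)%N ->
  ball_code n x = ball_code n y -> ball_code m x = ball_code m y.
Proof.
move=> mn xy; apply: eq_from_tnth => k; rewrite !tnth_mktuple.
have := congr1 (fun t => tnth t (widen_ord mn k)) xy.
by rewrite !tnth_mktuple.
Qed.

Lemma code_sep x y : x != y ->
  exists n, ball_code n x != ball_code n y.
Proof.
move=> /bball_separated[k [kx ky]]; exists k.+1.
apply/eqP => /(congr1 (fun t => tnth t ord_max)).
by rewrite !tnth_mktuple /= (mem_set kx) memNset.
Qed.

End WithBase.
End BallBase.
Arguments ball_code {d R E} c r n x.
Arguments ball_cell {d R E} c r n b.

(** * Counts of points are measurable *)

Section ConfMeasure.
Context d (R : realType) (E : borelMetricType d R).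
Implicit Types (X : conf E) (A B : set E).

Definition conf_supp X B : seq E :=
  finmap.enum_fset (fset_set (B `&` [set x | mult X x != 0%N])).

Lemma conf_supp_uniq X B : uniq (conf_supp X B).
Proof. exact: finmap.fset_uniq. Qed.

Lemma mem_conf_supp X B x : metric_bounded B ->
  (x \in conf_supp X B) = (x \in B) && (mult X x != 0%N).
Proof.
move=> bB; rewrite /conf_supp in_fset_set; last exact: conf_locally_finite.
by rewrite in_setI; congr (_ && _); apply/idP/idP; rewrite inE.
Qed.

Lemma conf_countE X A B : metric_bounded B -> A `<=` B ->
  conf_count X A = (\sum_(x <- conf_supp X B | x \in A) mult X x)%N.
Proof.
move=> bB AB; rewrite /conf_count (@fsbigE _ _ _ _ _ [seq x <- conf_supp X B | x \in A]).
  by rewrite big_filter_cond; under eq_bigl do rewrite andbb.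
- by rewrite filter_uniq// conf_supp_uniq.
- by move=> x /=; rewrite mem_filter => /andP[/set_mem].
- move=> x Ax; rewrite mem_filter mem_set//= mem_conf_supp//.
  by rewrite (mem_set (AB _ Ax)) /= negbK => /eqP.
Qed.

Lemma conf_integralE X (f : E -> R) B : metric_bounded B ->
  (forall x, ~ B x -> f x = 0) ->
  conf_integral X f = \sum_(x <- conf_supp X B) f x *+ mult X x.
Proof.
move=> bB fB; rewrite /conf_integral (@fsbigE _ _ _ _ _ (conf_supp X B)).
- by apply: eq_bigl => x; exact: mem_set.
- exact: conf_supp_uniq.
- by [].
move=> x _; rewrite mem_conf_supp// negb_and negbK => /orP[|/eqP ->//].
by rewrite notin_setE => /fB ->; rewrite mul0rn.
Qed.

(** The count of an unbounded set may be infinite, hence the extended real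
    values. As a measure, a configuration can be handled by monotone class
    arguments. *)
Definition confm X : set E -> \bar R := fun A => \esum_(x in A) (mult X x)%:R%:E.

Lemma confmE X A : metric_bounded A -> confm X A = (conf_count X A)%:R%:E.
Proof.
move=> bA; rewrite /confm (conf_countE X bA (@subset_refl _ A)).
rewrite esum_mkcond.
have -> : \esum_(i in [set: E]) (if i \in A then (mult X i)%:R%:E else 0%E) =
    \esum_(i in [set` conf_supp X A]) (mult X i)%:R%:E :> \bar R.
  rewrite [RHS]esum_mkcond; apply: eq_esum => x _.
  have -> : (x \in [set` conf_supp X A]) = (x \in conf_supp X A).
    by apply/idP/idP; rewrite inE.
  rewrite mem_conf_supp//; case: (x \in A) => //=.
  by case: eqP => [->|].
rewrite esum_fset; [|exact: finite_seq|by move=> x _; rewrite lee_fin].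
rewrite -fsbig_seq ?conf_supp_uniq// big_seq_cond [in RHS]big_seq_cond.
rewrite sumEFin natr_sum; congr EFin; apply: eq_bigl => x; rewrite andbT.
rewrite mem_conf_supp//; case: (x \in A); rewrite ?andbT ?andbF//=.
Qed.

Let confm0 X : confm X set0 = 0%E. Proof. exact: esum_set0. Qed.
Let confm_ge0 X A : (0 <= confm X A)%E.
Proof. by apply: esum_ge0 => x _; rewrite lee_fin. Qed.
Let confm_sigma_additive X : semi_sigma_additive (confm X).
Proof.
move=> F mF tF _; rewrite /confm esum_bigcupT//.
rewrite -nneseries_esumT; last by move=> n; exact: confm_ge0.
by apply: is_cvg_ereal_nneg_natsum => n _; exact: confm_ge0.
Qed.

HB.instance Definition _ X := isMeasure.Build _ _ _ (confm X)
  (confm0 X) (confm_ge0 X) (@confm_sigma_additive X).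

Lemma conf_count_sub X A B : metric_bounded B -> A `<=` B ->
  (conf_count X A <= conf_count X B)%N.
Proof.
move=> bB AB; rewrite (conf_countE X bB AB) (conf_countE X bB (@subset_refl _ B)).
rewrite big_mkcond [leqRHS]big_mkcond; apply: leq_sum => x _.
by case: ifP => // /set_mem/AB/mem_set ->.
Qed.

End ConfMeasure.

Section CountMeasurable.
Context d (R : realType) (E : borelMetricType d R).
Implicit Types (X : conf E) (A B : set E).

Lemma continuous_mdist (x : E) : continuous (fun y => mdist x y : R).
Proof.
move=> y; apply/cvgrPdist_lt => eps eps0.
apply: filterS (nbhsx_ballx y eps eps0) => z; rewrite ballEmdist /= => yz.
apply: le_lt_trans yz; rewrite ler_distl.
have h1 := metric_triangle x z y; have h2 := metric_triangle x y z.
have h3 := metric_sym y z; lra.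
Qed.

(** A continuous function that is positive exactly on the intersection of the
    balls of [L], so that the functions [ball_bump L n] below increase to the
    indicator of this intersection. *)
Fixpoint ball_height (L : seq (E * R)) (y : E) : R :=
  if L is (x, r) :: L' then Num.min (r - mdist x y) (ball_height L' y) else 1.

Lemma continuous_ball_height L : continuous (ball_height L).
Proof.
elim: L => [|[x r] L IHL] /= y; first exact: cvg_cst.
apply: (@continuous_min R E); last exact: IHL.
by apply: (@cvgB R R^o); [exact: cvg_cst|exact: continuous_mdist].
Qed.

Lemma ball_height_gt0 L y :
  (0 < ball_height L y) = all (fun p => mdist p.1 y < p.2) L.
Proof. by elim: L => [|[x r] L IHL]; rewrite /= ?ltr01// lt_min subr_gt0 IHL. Qed.

Lemma ball_heightP L y :
  0 < ball_height L y <-> forall p, p \in L -> ball p.1 p.2 y.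
Proof.
rewrite ball_height_gt0; split=> [/allP h p /h|h]; first by rewrite ballEmdist.
by apply/allP => p /h; rewrite ballEmdist.
Qed.

Definition ball_bump (L : seq (E * R)) (n : nat) (y : E) : R :=
  Num.min 1 (n%:R * Num.max 0 (ball_height L y)).

Lemma continuous_ball_bump L n : continuous (ball_bump L n).
Proof.
move=> y; apply: (@continuous_min R E); first exact: cvg_cst.
apply: cvgM; first exact: cvg_cst.
by apply: (@continuous_max R E); [exact: cvg_cst|exact: continuous_ball_height].
Qed.

Lemma ball_bump_cvg L y :
  ball_bump L n y @[n --> \oo] --> ((0 < ball_height L y)%R%:R : R).
Proof.
case: ltP => h0; last first.
  rewrite (_ : (fun n => _) = fun=> 0); first exact: cvg_cst.
  by apply/funext => n; rewrite /ball_bump max_l// mulr0 min_r.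
apply: cvg_near_cst; exists (Num.truncn (ball_height L y)^-1).+1 => // n /= nh.
rewrite /ball_bump max_r ?ltW// min_l// -ler_pdivrMr// div1r.
by apply: ltW; apply: lt_le_trans (Num.Theory.truncnS_gt _) _; rewrite ler_nat.
Qed.

Lemma ball_bump_out L n y : ~~ (0 < ball_height L y) -> ball_bump L n y = 0.
Proof. by rewrite -leNgt => h0; rewrite /ball_bump max_l// mulr0 min_r. Qed.

Lemma conf_open_subbase (f : E -> R) (U : set R) :
  compactly_supported_continuous f -> open U ->
  open [set X : conf E | U (conf_integral X f)].
Proof.
move=> cf oU.
exists [set [set X : conf E | U (conf_integral X f)]]; last by rewrite bigcup_set1.
move=> _ ->.
exact: (@finI_from1 ((E -> R) * set R)%type _
 [set fU | compactly_supported_continuous fU.1 /\ open fU.2]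
  (fun fU => [set X : conf E | fU.2 (conf_integral X fU.1)]) (f, U)).
Qed.

Lemma measurable_conf_integral (f : E -> R) :
  compactly_supported_continuous f ->
  measurable_fun setT (fun X : conf E => conf_integral X f).
Proof.
move=> cf; apply: (measurability _ (RGenOpens.measurableE R)).
move=> _ [_ [a [b ->] <-]]; rewrite setTI; apply: sub_sigma_algebra.
by apply: (conf_open_subbase cf); exact: interval_open.
Qed.

Hypothesis properE : forall B : set E, metric_bounded B -> precompact B.

Lemma ball_bump_compact L n x r : (x, r) \in L ->
  compactly_supported_continuous (ball_bump L n).
Proof.
move=> xrL; split; first exact: continuous_ball_bump.
rewrite -precompactE; apply: precompact_subset (properE (bounded_mball x r)).
move=> y /= /eqP; apply: contra_notP => xy; apply: ball_bump_out.
rewrite ball_height_gt0; apply/negP => /allP /(_ _ xrL) /= h.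
by apply: xy; rewrite ballEmdist.
Qed.

(** The count of the points in a bounded intersection of balls is the limit of
    the integrals of the bumps, which are measurable because the vague
    topology makes them continuous. *)
Lemma measurable_confm_balls L x r : (x, r) \in L ->
  measurable_fun setT (fun X : conf E => confm X [set y | 0 < ball_height L y]).
Proof.
move=> xrL; set G := [set y | _].
have Gr : G `<=` ball x r.
  by move=> y; rewrite /G /= ball_height_gt0 => /allP /(_ _ xrL); rewrite ballEmdist.
have bG := metric_bounded_sub Gr (bounded_mball x r).
under eq_fun do rewrite confmE//.
apply/measurable_EFinP.
apply: (@measurable_fun_cvg _ _ _ _ (fun n X => conf_integral X (ball_bump L n))).
  by move=> n; apply: measurable_conf_integral; exact: ball_bump_compact xrL.
move=> X _.
rewrite (_ : (fun n => _) = fun n =>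
    \sum_(y <- conf_supp X (ball x r)) ball_bump L n y *+ mult X y); last first.
  apply/funext => n; rewrite (conf_integralE X (bounded_mball x r))//.
  move=> y xy; apply: ball_bump_out; apply/negP => h; apply: xy; exact: Gr.
rewrite (conf_countE X (bounded_mball x r) Gr) natr_sum big_mkcond /=.
elim: (conf_supp _ _) => [|y s IHs].
  by under eq_fun do rewrite big_nil; rewrite big_nil; exact: cvg_cst.
under eq_fun do rewrite big_cons; rewrite big_cons.
apply: cvgD IHs.
rewrite (_ : (if _ then _ else _) = (0 < ball_height L y)%R%:R * (mult X y)%:R).
  by under eq_fun do rewrite -mulr_natr; apply: cvgMl; exact: ball_bump_cvg.
case: ifPn => [/set_mem -> //|/negP h]; first by rewrite mul1r.
by case: ltP => // h'; [case: h; exact: mem_set|rewrite mul0r].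
Qed.

Variables (c : nat -> E) (r : nat -> R).
Hypothesis cr : ball_base c r.

(** The passage from intersections of balls to Borel sets is Dynkin's
    argument, inside a fixed ball where the counts are finite. *)
Lemma measurable_confm (A : set E) : measurable A -> metric_bounded A ->
  measurable_fun setT (fun X : conf E => confm X A).
Proof.
move=> mA [x0 [m Am]].
suff h B : <<s base_inters c r >> B ->
    measurable_fun setT (fun X : conf E => confm X (B `&` ball x0 m)).
  by have := h A; rewrite -base_interE//; rewrite (setIidl Am); exact.
have mD := measurable_mball x0 m.
have bD := bounded_mball x0 m.
move: B; apply: (dynkin_induction (G := base_inters c r)).
- exact: base_interE.
- exact: setI_closed_base_inters.
- rewrite setTI (_ : ball x0 m = [set y | 0 < ball_height [:: (x0, m)] y]).
    by apply: (measurable_confm_balls (x := x0) (r := m)); rewrite inE.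
  apply/seteqP; split => y.
      by move=> h; apply: (ball_heightP _ _).2 => p; rewrite inE => /eqP ->.
    by move=> h; apply: ((ball_heightP _ _).1 h (x0, m)); rewrite inE.
- move=> _ [s _ <-].
  rewrite (_ : _ `&` _ =
     [set y | 0 < ball_height ((x0, m) :: [seq (c k, r k) | k <- s]) y]).
    by apply: (measurable_confm_balls (x := x0) (r := m)); rewrite inE eqxx.
  apply/seteqP; split => y.
    move=> [sy my]; apply: (ball_heightP _ _).2 => p; rewrite inE => /orP[/eqP ->//|].
    by move=> /mapP[k ks ->]; exact: sy.
  move=> /((ball_heightP _ _).1) h; split; last by apply: (h (x0, m)); rewrite inE eqxx.
  by move=> k ks; apply: (h (c k, r k)); rewrite inE map_f ?orbT.
- move=> S mS hS.
  rewrite (_ : (fun X : conf E => _) =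
      (fun X : conf E => confm X (setT `&` ball x0 m) - confm X (S `&` ball x0 m))%E).
    apply: emeasurable_funB => //.
    rewrite setTI (_ : ball x0 m = [set y | 0 < ball_height [:: (x0, m)] y]).
      by apply: (measurable_confm_balls (x := x0) (r := m)); rewrite inE.
    apply/seteqP; split => y.
      by move=> h; apply: (ball_heightP _ _).2 => p; rewrite inE => /eqP ->.
    by move=> h; apply: ((ball_heightP _ _).1 h (x0, m)); rewrite inE.
  apply/funext => X.
  have fin : (confm X (ball x0 m) < +oo)%E by rewrite confmE// ltry.
  rewrite setTI setIC -setDE measureD//.
  by rewrite setIC.
- move=> F mF tF hF.
  rewrite (_ : (fun X : conf E => _) =
      (fun X : conf E => \sum_(i <oo | i \in xpredT) confm X (F i `&` ball x0 m))%E).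
    exact: ge0_emeasurable_sum.
  apply/funext => X; rewrite setI_bigcupl measure_bigcup//; last exact: trivIset_setIr.
    by apply: eq_eseriesl => i; rewrite in_setT.
  by move=> k _; exact: measurableI.
Qed.

Lemma measurable_conf_count (A : set E) : measurable A -> metric_bounded A ->
  measurable_fun setT (fun X : conf E => (conf_count X A)%:R : R).
Proof.
move=> mA bA; apply/measurable_EFinP.
rewrite (_ : _ \o _ = fun X => confm X A); first exact: measurable_confm.
by apply/funext => X; rewrite /= confmE.
Qed.

End CountMeasurable.

(** * Factorial moments through distinct cells *)

Lemma leq_ffact2l m n k : (m <= n)%N -> (m ^_ k <= n ^_ k)%N.
Proof.
elim: k m n => [|k IHk] [|m] [|n] mn; rewrite ?ffact0n//.
by rewrite !ffactSS leq_mul// IHk.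
Qed.

Lemma big_cons_tuple (T : finType) (k : nat) (Q : pred (k.+1.-tuple T))
    (F : k.+1.-tuple T -> nat) :
  (\sum_(b | Q b) F b =
   \sum_(c : T) \sum_(b : k.-tuple T | Q (cons_tuple c b)) F (cons_tuple c b))%N.
Proof.
rewrite pair_big_dep /=.
rewrite (reindex (fun p : T * k.-tuple T => cons_tuple p.1 p.2))//.
exists (fun b => (thead b, [tuple of behead b])).
  by move=> [x y] _; congr pair => //; exact: val_inj.
by move=> b _; apply: val_inj; case: b => -[].
Qed.

Section DistinctCells.
Variables (J T : finType) (f : J -> T -> nat).

(** If [f a c] is the number of points that the set [a] has in the cell [c],
    this counts the ways to choose, for each [i], a point of the set [tnth s
    i], all in distinct cells that avoid [z]. *)
Definition distinct_sum k (s : k.-tuple J) (z : seq T) : nat :=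
  (\sum_(b : k.-tuple T | uniq b && all (fun c => c \notin z) b)
    \prod_(i < k) f (tnth s i) (tnth b i))%N.

Definition cell_total (z : seq T) (a : J) : nat := (\sum_(c | c \notin z) f a c)%N.

Lemma distinct_sum0 (s : 0.-tuple J) z : distinct_sum s z = 1%N.
Proof.
rewrite /distinct_sum (big_pred1 [tuple]) ?big_ord0// => b.
by rewrite tuple0.
Qed.

Lemma distinct_sumS k a (s : k.-tuple J) z :
  distinct_sum (cons_tuple a s) z =
  (\sum_(c | c \notin z) f a c * distinct_sum s (c :: z))%N.
Proof.
rewrite /distinct_sum big_cons_tuple [RHS]big_mkcond /=; apply: eq_bigr => c _.
case: ifPn => cz; last first.
  by rewrite big_pred0// => b; rewrite andbCA.
rewrite big_distrr; apply: eq_big => [b|b _]; last first.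
  by rewrite big_ord_recl /=; congr (_ * _)%N; apply: eq_bigr => i _; rewrite !tnthS.
rewrite /= -andbA [_ && (uniq _ && _)]andbCA; congr (_ && _).
have -> : all (fun x => x \notin c :: z) b = (c \notin tval b) && all (fun x => x \notin z) b.
  apply/idP/andP => [/allP h|[cb /allP h]].
    split; last by apply/allP => x /h; rewrite inE negb_or => /andP[].
    by apply/negP => /h; rewrite inE eqxx.
  apply/allP => x xb; rewrite inE negb_or h// andbT.
  by apply: contraNneq cb => <-.
by [].
Qed.

Lemma cell_total_cons z a c : c \notin z ->
  cell_total z a = (f a c + cell_total (c :: z) a)%N.
Proof.
move=> cz; rewrite /cell_total (bigD1 c)//=; congr addn.
by apply: eq_bigl => x; rewrite inE negb_or andbC.
Qed.

Let W k (s : k.-tuple J) z a :=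
  ((cell_total z a).-1 ^_ (count_mem a s) *
   \prod_(a' | a' != a) cell_total z a' ^_ (count_mem a' s))%N.

Let WE k (s : k.-tuple J) z a :
  (\sum_(c | c \notin z) f a c * W s z a =
   \prod_a' cell_total z a' ^_ (count_mem a' (a :: s)))%N.
Proof.
rewrite -big_distrl /= -/(cell_total z a) /W mulnA [RHS](bigD1 a)//= eqxx.
rewrite ffactnS; congr (_ * _)%N.
by apply: eq_bigr => a' /negbTE h; rewrite eq_sym h add0n.
Qed.

(** The points are chosen one after the other. Each choice forbids its own
    cell, so the set it was made in loses at least one point. *)
Lemma distinct_sum_le k (s : k.-tuple J) z :
  (distinct_sum s z <= \prod_a cell_total z a ^_ (count_mem a s))%N.
Proof.
elim: k s z => [|k IHk] s z; first by rewrite distinct_sum0 (tuple0 s) big1.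
case/tupleP: s => a s; rewrite distinct_sumS -WE; apply: leq_sum => c cz.
case: (posnP (f a c)) => [->|fac]; first by rewrite !mul0n.
rewrite leq_mul2l; apply/orP; right; apply: leq_trans (IHk _ _) _.
rewrite (bigD1 a)//=; apply: leq_mul.
  apply: leq_ffact2l; rewrite (cell_total_cons a cz).
  by rewrite -subn1 -addnBAC// leq_addl.
apply: leq_prod => a' _; apply: leq_ffact2l.
by rewrite (cell_total_cons a' cz) leq_addl.
Qed.

(** When the cells hold at most one point each, a choice forbids exactly the
    point chosen. *)
Lemma distinct_sum_eq k (s : k.-tuple J) z :
  (forall c, c \notin z -> \sum_a f a c <= 1)%N ->
  distinct_sum s z = (\prod_a cell_total z a ^_ (count_mem a s))%N.
Proof.
elim: k s z => [|k IHk] s z f1; first by rewrite distinct_sum0 (tuple0 s) big1.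
case/tupleP: s => a s; rewrite distinct_sumS -WE; apply: eq_bigr => c cz.
case: (posnP (f a c)) => [->|fac]; first by rewrite !mul0n.
have := f1 c cz; rewrite (bigD1 a)//= => fc.
have fa1 : f a c = 1%N.
  by apply/eqP; rewrite eqn_leq fac andbT (leq_trans _ fc)// leq_addr.
have fa'0 a' : a' != a -> f a' c = 0%N.
  move=> a'a; apply/eqP; move: fc; rewrite fa1 addnC addn1 ltnS leqn0.
  by rewrite sum_nat_eq0 => /forall_inP /(_ _ a'a).
congr muln; rewrite IHk; last first.
  by move=> x; rewrite inE negb_or => /andP[_ /f1].
rewrite (bigD1 a)//=; congr muln.
  by rewrite (cell_total_cons a cz) fa1 add1n.
by apply: eq_bigr => a' /fa'0 h; rewrite (cell_total_cons a' cz) h add0n.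
Qed.

End DistinctCells.

Lemma measurable_nat_comp d (T : measurableType d) (R : realType) (g : T -> nat)
    d' (T' : measurableType d') (h : nat -> T') :
  measurable_fun setT (fun x => (g x)%:R : R) -> measurable_fun setT (fun x => h (g x)).
Proof.
move=> mg _ Y mY; rewrite setTI.
rewrite (_ : _ @^-1` _ = \bigcup_(n in [set n | Y (h n)]) (fun x => (g x)%:R) @^-1` [set n%:R : R]).
  apply: bigcup_measurable => n _; rewrite -[X in measurable X]setTI.
  by apply: mg => //; exact: measurable_set1.
apply/seteqP; split => [x Yx|x [n Yn /= /eqP]]; first by exists (g x).
by rewrite eqr_nat => /eqP ->.
Qed.

Section Cells.
Context d (R : realType) (E : borelMetricType d R).
Variables (c : nat -> E) (r : nat -> R).
Hypothesis cr : ball_base c r.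
Notation code := (ball_code c r).
Notation cell := (ball_cell c r).

Lemma map_code_sep (x : E) (l : seq E) : x \notin l ->
  exists n, forall m, (n <= m)%N -> code m x \notin map (code m) l.
Proof.
elim: l => [_|y l IHl]; first by exists 0%N.
rewrite inE negb_or => /andP[xy /IHl[n hn]].
have [n' hn'] := code_sep cr xy.
exists (maxn n n') => m; rewrite geq_max => /andP[nm n'm] /=.
rewrite inE negb_or hn// andbT; apply: contraNneq hn' => /(code_le n'm) ->.
by rewrite eqxx.
Qed.

Definition codes_distinct n (z l : seq E) : bool :=
  uniq (map (code n) l) && all (fun b => b \notin map (code n) z) (map (code n) l).

Lemma codes_distinct_ex (z l : seq E) : uniq l -> all (fun x => x \notin z) l ->
  exists n, codes_distinct n z l.
Proof.
move=> ul al.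
suff [n hn] : exists n, forall m, (n <= m)%N -> codes_distinct m z l.
  by exists n; exact: hn.
elim: l ul al => [|x l IHl] /=; first by exists 0%N.
move=> /andP[xl ul] /andP[xz al].
have [n1 h1] := IHl ul al.
have [n2 h2] := map_code_sep xl; have [n3 h3] := map_code_sep xz.
exists (maxn n1 (maxn n2 n3)) => m; rewrite !geq_max => /and3P[m1 m2 m3].
rewrite /codes_distinct /= h2// h3//=.
exact: h1.
Qed.

Lemma codes_distinct_le (z l : seq E) m n : (m <= n)%N ->
  codes_distinct m z l -> codes_distinct n z l.
Proof.
move=> mn /andP[ul /allP al]; apply/andP; split.
  elim: l ul {al} => //= x l IHl /andP[xl /IHl ->]; rewrite andbT.
  apply: contra xl => /mapP[y yl /(code_le mn) ->]; exact: map_f.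
apply/allP => _ /mapP[x xl ->].
have := al _ (map_f _ xl); apply: contra => /mapP[y yz /(code_le mn) ->].
exact: map_f.
Qed.

Lemma codes_distinct_uniq n (z l : seq E) : codes_distinct n z l ->
  uniq l /\ all (fun x => x \notin z) l.
Proof.
move=> /andP[ul /allP al]; split; first exact: map_uniq ul.
apply/allP => x xl; have := al _ (map_f _ xl); apply: contra => xz.
exact: map_f.
Qed.

Lemma conf_count_cells (X : conf E) (A : set E) n : metric_bounded A ->
  conf_count X A = (\sum_(b : n.-tuple bool) conf_count X (A `&` cell n b))%N.
Proof.
move=> bA.
under eq_bigr => b _ do rewrite (conf_countE X bA (@subIsetl _ _ _)).
rewrite (exchange_big_dep predT) //= (conf_countE X bA (@subset_refl _ A)).
rewrite big_mkcond; apply: eq_bigr => x _.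
case: ifPn => xA.
  rewrite (big_pred1 (code n x)) ?eqxx// => b.
  by rewrite in_setI xA /=; apply/idP/eqP; rewrite inE => ->.
by rewrite big_pred0// => b; rewrite in_setI (negbTE xA).
Qed.

Lemma conf_count_disj (J : finType) (X : conf E) (D : set E) (A : J -> set E) :
  metric_bounded D -> (forall a, A a `<=` D) -> trivIset setT A ->
  (\sum_a conf_count X (A a) <= conf_count X D)%N.
Proof.
move=> bD AD tA.
under eq_bigr => a _ do rewrite (conf_countE X bD (AD a)).
rewrite (exchange_big_dep predT) //= (conf_countE X bD (@subset_refl _ D)).
rewrite [leqRHS]big_mkcond; apply: leq_sum => x _.
case: (pselect (exists a, A a x)) => [[a Aax]|Nx].
  rewrite (mem_set (AD _ _ Aax)) (big_pred1 a)// => b.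
  apply/idP/eqP => [/set_mem Abx|->]; last exact: mem_set.
  by apply: (tA b a I I); exists x.
rewrite big_pred0// => a; apply/negbTE; rewrite notin_setE => Aax.
by apply: Nx; exists a.
Qed.

End Cells.
Arguments codes_distinct {d R E} c r n z l.

Section Boxes.
Context d (R : realType) (E : borelMetricType d R).

Definition box k (B : 'I_k -> set E) : set (k.-tuple E) :=
  [set x | forall i, B i (tnth x i)].

Lemma measurable_box k (B : 'I_k -> set E) : (forall i, measurable (B i)) ->
  measurable (box B).
Proof.
move=> mB; rewrite (_ : box B = \bigcap_i ((@tnth _ E)^~ i @^-1` B i)).
  apply: fin_bigcap_measurable => // i _.
  by rewrite -[X in measurable X]setTI; exact: measurable_tnth.
by apply/seteqP; split => [x Bx i _|x Bx i]; apply: Bx.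
Qed.

Definition conf_prod (X : conf E) k (B : 'I_k -> set E) : nat :=
  (\prod_(i < k) conf_count X (B i))%N.
End Boxes.

Section FactorialMoment.
Context d (R : realType) (E : borelMetricType d R).
Hypothesis properE : forall B : set E, metric_bounded B -> precompact B.
Variables (c : nat -> E) (r : nat -> R).
Hypothesis cr : ball_base c r.
Notation code := (ball_code c r).
Notation cell := (ball_cell c r).

Lemma measurable_conf_prod k (B : 'I_k -> set E) :
  (forall i, measurable (B i)) -> (forall i, metric_bounded (B i)) ->
  measurable_fun setT (fun X : conf E => (conf_prod X B)%:R : R).
Proof.
move=> mB bB; rewrite /conf_prod; under eq_fun do rewrite natr_prod.
by apply: measurable_prod => i _; exact: (measurable_conf_count properE cr).
Qed.

(** That this holds at some level says, through countably many counts, that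
    [X] has no multiple point in [D] and contains no point of [z] that lies in
    [D]. *)
Definition cell_simple (z : seq E) (D : set E) n (X : conf E) : Prop :=
  forall b : n.-tuple bool,
    (conf_count X (D `&` cell n b) <= (b \notin map (code n) z))%N.

Lemma cell_simple_le z D m n X : metric_bounded D -> (m <= n)%N ->
  cell_simple z D m X -> cell_simple z D n X.
Proof.
move=> bD mn sm b.
pose t := [tuple tnth b (widen_ord mn i) | i < m].
have sub : cell n b `<=` cell m t.
  move=> x bx; apply: eq_from_tnth => i; rewrite !tnth_mktuple.
  by rewrite -[b]bx tnth_mktuple.
apply: (@leq_trans (conf_count X (D `&` cell m t))).
  apply: conf_count_sub; first by apply: metric_bounded_sub bD; exact: subIsetl.
  exact: setIS.
apply: leq_trans (sm t) _.
case: (boolP (b \in _)) => [/mapP[x xz bx]|_]; last by case: (_ \notin _).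
suff -> : t \in map (code m) z by [].
by apply/mapP; exists x => //; symmetry; apply: sub; rewrite /cell /= bx.
Qed.

Variables (Q : probability (conf E) R) (D : set E).
Hypothesis bD : metric_bounded D.
Variables (J : finType) (A : J -> set E).
Hypotheses (mA : forall a, measurable (A a)) (AD : forall a, A a `<=` D).
Hypothesis tA : trivIset setT A.
Variables (k : nat) (s : k.-tuple J) (z : seq E).
Variable lam : {measure set (k.-tuple E) -> \bar R}.

Hypothesis Q_simple : {ae Q, forall X, exists n, cell_simple z D n X}.
Hypothesis Q_box : forall n (b : k.-tuple (n.-tuple bool)),
  uniq b -> all (fun x => x \notin map (code n) z) b ->
  (\int[Q]_X (conf_prod X (fun i => A (tnth s i) `&` cell n (tnth b i)))%:R%:E =
   lam (box (fun i => A (tnth s i) `&` cell n (tnth b i))))%E.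

Let f X n (a : J) (b : n.-tuple bool) : nat := conf_count X (A a `&` cell n b).

Let G n (X : conf E) : nat := distinct_sum (f X (n := n)) s (map (code n) z).

Let L (X : conf E) : nat :=
  (\prod_a conf_count X (A a) ^_ (count_mem a s))%N.

Let bA a : metric_bounded (A a). Proof. exact: (metric_bounded_sub (@AD a) bD). Qed.

Let bAI a B : metric_bounded (A a `&` B).
Proof. by apply: metric_bounded_sub (bA a); exact: subIsetl. Qed.

Let total_le n X a : (cell_total (f X (n := n)) (map (code n) z) a <= conf_count X (A a))%N.
Proof.
rewrite (conf_count_cells c r X n (bA a)) /cell_total [leqLHS]big_mkcond.
by apply: leq_sum => b _; case: ifP.
Qed.

Let G_le n X : (G n X <= L X)%N.
Proof.
apply: leq_trans (distinct_sum_le _ _ _) _; apply: leq_prod => a _.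
exact: leq_ffact2l.
Qed.

Let G_eq n X : cell_simple z D n X -> G n X = L X.
Proof.
move=> sX; rewrite /G distinct_sum_eq => [|b bz]; last first.
  apply: leq_trans (_ : conf_count X (D `&` cell n b) <= _)%N; last first.
    by apply: leq_trans (sX b) _; case: (_ \notin _).
  apply: conf_count_disj => //.
  - by apply: metric_bounded_sub bD; exact: subIsetl.
  - by move=> a; apply: setSI.
  - exact: trivIset_setIr.
apply: eq_bigr => a _; congr (_ ^_ _)%N.
rewrite (conf_count_cells c r X n (bA a)) /cell_total [LHS]big_mkcond.
apply: eq_bigr => b _; case: ifPn => // /negPn bz.
apply/esym/eqP; rewrite -leqn0; have := sX b; rewrite bz /=; apply: leq_trans.
apply: conf_count_sub; first by apply: metric_bounded_sub bD; exact: subIsetl.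
exact: setSI.
Qed.

Let S n : set (k.-tuple E) :=
  box (fun i => A (tnth s i)) `&` [set x | codes_distinct c r n z x].

Let Sbox n (b : k.-tuple (n.-tuple bool)) : set (k.-tuple E) :=
  box (fun i => A (tnth s i) `&` cell n (tnth b i)).

Let okb n (b : k.-tuple (n.-tuple bool)) :=
  uniq b && all (fun x => x \notin map (code n) z) b.

Let S_cover n : S n = \bigcup_(b in [set b : k.-tuple (n.-tuple bool) | okb b]) Sbox b.
Proof.
apply/seteqP; split => [x [xA xd]|x [b bok xb]].
  exists [tuple of map (code n) x] => //.
  by move=> i; split; [exact: xA|rewrite tnth_map].
split; first by move=> i; have [] := xb i.
rewrite /= /codes_distinct (_ : map _ x = tval b) //.
suff -> : b = [tuple of map (code n) x] by [].
by apply: eq_from_tnth => i; rewrite tnth_map; have [_ <-] := xb i.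
Qed.

Let S_triv n : trivIset setT (@Sbox n).
Proof.
move=> b b' _ _ [x [xb xb']]; apply: eq_from_tnth => i.
by have [_ <-] := xb i; have [_ <-] := xb' i.
Qed.

Let mSbox n (b : k.-tuple (n.-tuple bool)) : measurable (Sbox b).
Proof. by apply: measurable_box => i; apply: measurableI => //; exact: measurable_cell. Qed.

Let mS n : measurable (S n).
Proof. by rewrite S_cover; apply: fin_bigcup_measurable. Qed.

Let lamS n : lam (S n) = (\int[Q]_X (G n X)%:R%:E)%E.
Proof.
rewrite S_cover measure_fin_bigcup//; [|exact: finite_finset|exact: sub_trivIset (@S_triv n)].
rewrite /G /distinct_sum.
under eq_integral => X _.
  rewrite natr_sum -sumEFin big_mkcond /=.
  over.
rewrite ge0_integral_sum//; last 2 first.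
- move=> b; case: (uniq b && _); last exact: measurable_cst.
  apply/measurable_EFinP; apply: measurable_conf_prod => // i.
  by apply: measurableI => //; exact: measurable_cell.
- by move=> b X _; case: ifP => _; rewrite lee_fin.
rewrite -(@bigfs _ _ _ _ (index_enum _) (@okb n))//; last 2 first.
- exact: index_enum_uniq.
- by move=> b _; rewrite mem_index_enum.
rewrite big_mkcond; apply: eq_bigr => b _.
rewrite -/(okb b); case: (boolP (okb b)) => [/andP[ub ab]|_]; last first.
  by rewrite integral0_eq.
exact/esym/Q_box.
Qed.

(** Adding up [Q_box] over distinct cells that avoid [z] gives the expectation
    of [distinct_sum] at level [n]. It is at most the factorial moment, and
    [distinct_sum] is eventually equal to the product of falling factorials on
    almost every [X], so Fatou's lemma gives the other inequality in the
    limit. On the side of [lam], the boxes of distinct cells exhaust the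
    tuples without repetition that avoid [z]. The use of [z] is that the
    moments of a Palm measure are known only on cells away from its base
    point. *)
Lemma factorial_moment :
  (\int[Q]_X (\prod_a conf_count X (A a) ^_ (count_mem a s))%N%:R%:E =
   lam (box (fun i => A (tnth s i)) `&`
        [set x | uniq x && all (fun y => y \notin z) x]))%E.
Proof.
set W := (X in lam X).
have WE : W = \bigcup_n S n.
  apply/seteqP; split => [x [xA /andP[ux zx]]|x [n _ [xA xd]]].
    by have [n hn] := codes_distinct_ex cr ux zx; exists n.
  by split => //=; have [-> ->] := codes_distinct_uniq xd.
have cvS : lam (S n) @[n --> \oo] --> lam W.
  rewrite WE; apply: nondecreasing_cvg_mu => //.
    by apply: bigcupT_measurable.
  move=> m n mn; apply/subsetPset => x [xA xd]; split => //.
  exact: codes_distinct_le xd.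
have mG n : measurable_fun setT (fun X : conf E => (G n X)%:R%:E : \bar R).
  rewrite /G /distinct_sum; apply/measurable_EFinP.
  under eq_fun do rewrite natr_sum -big_filter.
  apply: measurable_sum => b; apply: measurable_conf_prod => // i.
  by apply: measurableI => //; exact: measurable_cell.
have mL : measurable_fun setT (fun X : conf E => (L X)%:R%:E : \bar R).
  rewrite /L; apply/measurable_EFinP; under eq_fun do rewrite natr_prod.
  apply: measurable_prod => a _.
  apply: (@measurable_nat_comp _ _ R (fun X => conf_count X (A a)) _ _
    (fun n => (n ^_ (count_mem a s))%:R : R)).
  exact: (measurable_conf_count properE cr).
apply/eqP; rewrite eq_le; apply/andP; split; last first.
  apply: (cvge_to_le cvS); apply: nearW => n; rewrite lamS.
  by apply: ge0_le_integral => // X _; rewrite lee_fin ler_nat G_le.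
have fat := @fatou _ _ _ Q setT measurableT (fun n X => (G n X)%:R%:E) mG
  (fun n X _ => ltac:(by rewrite lee_fin)).
rewrite -[leRHS](cvg_limn_einf_sup cvS).1.
rewrite (_ : (fun n => lam (S n)) = fun n => \int[Q]_X (G n X)%:R%:E)%E; last first.
  by apply/funext => n; rewrite lamS.
apply: le_trans fat; apply: ae_ge0_le_integral => //.
- move=> X _; rewrite limn_einf_lim; apply: lime_ge; first exact: is_cvg_einfs.
  apply: nearW => n; apply: le_ereal_inf_tmp => _ [m _ <-]; by rewrite lee_fin.
- under eq_fun do rewrite /limn_einf.
  apply: measurableT_comp => //; apply: measurable_fun_limn_esup => n.
  exact: measurableT_comp.
case: Q_simple => N [mN QN0 sub]; exists N; split => // X /= /not_implyP[_ Xn].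
apply: sub => /= -[n sn]; apply: Xn.
rewrite (cvg_limn_einf_sup (l := (L X)%:R%:E) _).1//.
apply: cvg_near_cst; exists n => // m /= nm.
by rewrite G_eq//; exact: cell_simple_le sn.
Qed.

End FactorialMoment.

(** * Densities, and integration over a power of the measure *)

Section Density.
Context d (T : measurableType d) (R : realType).
Variables (m : {measure set T -> \bar R}) (f : T -> R).
Hypotheses (mf : measurable_fun setT f) (f0 : forall x, 0 <= f x).
Local Open Scope ereal_scope.

Definition density_measure (A : set T) : \bar R := \int[m]_(x in A) (f x)%:E.

Let density0 : density_measure set0 = 0.
Proof. by rewrite /density_measure integral_set0. Qed.

Let density_ge0 A : 0 <= density_measure A.
Proof. by apply: integral_ge0 => x _; rewrite lee_fin. Qed.

Let density_sigma_additive : semi_sigma_additive density_measure.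
Proof.
move=> F mF tF mUF; rewrite /density_measure ge0_integral_bigcup//; last 2 first.
- by apply/measurable_EFinP; exact: measurable_funTS.
- by move=> x _; rewrite lee_fin.
by apply: is_cvg_ereal_nneg_natsum => n _; exact: density_ge0.
Qed.

HB.instance Definition _ := isMeasure.Build _ _ _ density_measure
  density0 density_ge0 density_sigma_additive.

Import HBNNSimple.

Lemma integral_density_measure (g : T -> \bar R) :
  measurable_fun setT g -> (forall x, 0 <= g x) ->
  \int[density_measure]_x g x = \int[m]_x (g x * (f x)%:E).
Proof.
move=> mg g0; pose h := nnsfun_approx measurableT mg.
have mfE : measurable_fun setT (fun x => (f x)%:E) by apply/measurable_EFinP.
have hg x : (h n x)%:E @[n --> \oo] --> g x by exact: cvg_nnsfun_approx.
have L : \int[density_measure]_x g x =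
    limn (fun n => \int[density_measure]_x (h n x)%:E).
  rewrite -monotone_convergence//.
  - by apply: eq_integral => x _; apply/esym/cvg_lim => //; exact: hg.
  - by move=> n; exact/measurable_EFinP.
  - by move=> n x _; rewrite lee_fin.
  - by move=> x _ a b ab; rewrite lee_fin; exact/lefP/nd_nnsfun_approx.
have Rr : \int[m]_x (g x * (f x)%:E) =
    limn (fun n => \int[m]_x ((h n x)%:E * (f x)%:E)).
  rewrite -monotone_convergence//.
  - apply: eq_integral => x _; apply/esym/cvg_lim => //.
    by apply: cvgeZr => //; exact: hg.
  - by move=> n; apply: emeasurable_funM => //; exact/measurable_EFinP.
  - by move=> n x _; rewrite mule_ge0// lee_fin.
  - move=> x _ a b ab; rewrite lee_wpmul2r ?lee_fin//.
    exact/lefP/nd_nnsfun_approx.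
rewrite L Rr; congr (limn _); apply/funext => n.
pose t r x : \bar R := (r * \1_(h n @^-1` [set r]) x)%:E.
have t0 r x : 0 <= t r x by exact: nnfun_muleindic_ge0.
have mt r : measurable_fun setT (t r).
  by apply/measurable_EFinP; exact: measurable_funM.
have hE x : (h n x)%:E = \sum_(r \in range (h n)) t r x.
  by rewrite fimfunE -fsumEFin.
under eq_integral do rewrite hE ge0_mule_fsuml//.
under [LHS]eq_integral do rewrite hE.
rewrite (@ge0_integral_fsum _ _ _ _ _ _ _ t)//.
rewrite (@ge0_integral_fsum _ _ _ _ _ _ _ (fun r x => t r x * (f x)%:E))//; last 2 first.
- by move=> r; exact: emeasurable_funM.
- by move=> r x _; rewrite mule_ge0// lee_fin.
apply: eq_fsbigr => r /set_mem [x _ rx].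
have r0 : (0 <= r)%R by rewrite -rx.
rewrite /t; under eq_integral do rewrite EFinM.
under [RHS]eq_integral do rewrite EFinM -muleA.
have mr : measurable (h n @^-1` [set r]).
  by rewrite -[X in measurable X]setTI; exact: measurable_funP.
rewrite !ge0_integralZl//; last 3 first.
- by apply: emeasurable_funM => //; exact/measurable_EFinP.
- by move=> y _; rewrite mule_ge0// lee_fin.
- exact/measurable_EFinP.
congr (_ * _); rewrite integral_indic// setIT /density_measure.
rewrite [LHS]integral_mkcond; apply: eq_integral => y _.
by rewrite epatch_indic muleC.
Qed.

End Density.

Section PowerFubini.
Context d (E : measurableType d) (R : realType).
Variable mu : {sigma_finite_measure set E -> \bar R}.
Local Open Scope ereal_scope.

Lemma integral_mpowS k (f : k.+1.-tuple E -> \bar R) :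
  measurable_fun setT f -> (forall y, 0 <= f y) ->
  \int[mpow mu k.+1]_y f y = \int[mu]_x \int[mpow mu k]_p f (consp (x, p)).
Proof.
move=> mf f0.
have mc := @measurable_consp _ E k.
rewrite -[LHS]/(\int[pushforward (mu \x mpow mu k) (@consp _ E k)]_y f y).
rewrite (ge0_integral_pushforward mc)// preimage_setT fubini_tonelli1//.
  by apply: measurableT_comp.
by move=> x; exact: f0.
Qed.

Lemma measurable_fun_integral_mpow k (f : k.+1.-tuple E -> \bar R) :
  measurable_fun setT f -> (forall y, 0 <= f y) ->
  measurable_fun setT (fun x => \int[mpow mu k]_p f (consp (x, p))).
Proof.
move=> mf f0.
apply: (@measurable_fun_fubini_tonelli_F _ _ _ _ _ (mpow mu k) (f \o @consp _ E k)) => //.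
  by apply: measurableT_comp => //; exact: measurable_consp.
by move=> x; exact: f0.
Qed.

Lemma integral_mpow1 (f : 1.-tuple E -> \bar R) :
  measurable_fun setT f -> (forall y, 0 <= f y) ->
  \int[mpow mu 1]_q f q = \int[mu]_x f [tuple x].
Proof.
move=> mf f0; rewrite integral_mpowS//; apply: eq_integral => x _.
rewrite /= integral_dirac// ?diracT ?mul1e.
  by congr f; exact: val_inj.
by apply: measurableT_comp => //; apply: (measurableT_comp (@measurable_consp _ E 0)).
Qed.

Lemma measurable_thead k : measurable_fun setT (fun q : k.+1.-tuple E => thead q).
Proof. exact: measurable_tnth. Qed.

Lemma measurable_thead_preimage k (B : set E) : measurable B ->
  measurable (@thead k E @^-1` B).
Proof.
by move=> mB; rewrite -[X in measurable X]setTI; exact: (@measurable_thead k).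
Qed.

Lemma set_tuple1E (S : set (1.-tuple E)) :
  S = @thead _ E @^-1` [set x | S [tuple x]].
Proof.
by apply/seteqP; split => q /=; case/tupleP: q => x t; rewrite (tuple0 t) theadE.
Qed.

Lemma measurable_set_tuple1 (S : set (1.-tuple E)) : measurable S ->
  measurable [set x | S [tuple x]].
Proof.
move=> mS; rewrite -[X in measurable X]setTI.
by apply: (measurable_cons (n := 0) (f := idfun) (g := fun=> [tuple])) => //;
  exact: measurable_id.
Qed.

Lemma integral_mpow_split k (f : k.+1.-tuple E -> \bar R) :
  measurable_fun setT f -> (forall y, 0 <= f y) ->
  \int[mpow mu k.+1]_y f y =
  \int[mpow mu 1]_q \int[mpow mu k]_p f (consp (thead q, p)).
Proof.
move=> mf f0; rewrite integral_mpowS// integral_mpow1//.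
- apply: (measurableT_comp (measurable_fun_integral_mpow mf f0)).
  exact: measurable_thead.
- by move=> q; apply: integral_ge0 => p _.
Qed.

Lemma measurable_split_integral k (f : k.+1.-tuple E -> \bar R) :
  measurable_fun setT f -> (forall y, 0 <= f y) ->
  measurable_fun setT (fun q : 1.-tuple E => \int[mpow mu k]_p f (consp (thead q, p))).
Proof.
move=> mf f0; apply: (measurableT_comp (measurable_fun_integral_mpow mf f0)).
exact: measurable_thead.
Qed.

Lemma ae_integral0 d' (T : measurableType d') (m : {measure set T -> \bar R})
    (f : T -> \bar R) : measurable_fun setT f -> (forall x, 0 <= f x) ->
  \int[m]_x f x = 0 -> {ae m, forall x, f x = 0}.
Proof.
move=> mf f0 If.
have : \int[m]_x `|f x| = 0 by under eq_integral do rewrite gee0_abs//.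
move=> /(ae_eq_integral_abs m measurableT mf); apply: filterS => x; exact.
Qed.

(** Fubini's theorem for null sets. The first coordinate is kept as a 1-tuple,
    the form in which the base point of a Palm measure comes. *)
Lemma ae_mpow_split k (Phi : k.+1.-tuple E -> Prop) :
  {ae mpow mu k.+1, forall y, Phi y} ->
  {ae mpow mu 1, forall q,
     {ae mpow mu k, forall p, Phi (consp (thead q, p))}}.
Proof.
move=> [N [mN N0 sub]].
have mI : measurable_fun setT (fun y => (\1_N y)%:E : \bar R).
  by apply/measurable_EFinP; exact: measurable_indic.
have I0 y : 0 <= (\1_N y)%:E :> \bar R by rewrite lee_fin.
have : \int[mpow mu k.+1]_y (\1_N y)%:E = 0 by rewrite integral_indic// setIT.
rewrite integral_mpow_split// => /(ae_integral0 (measurable_split_integral mI I0)).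
have h (q : 1.-tuple E) : 0 <= \int[mpow mu k]_p (\1_N (consp (thead q, p)))%:E :> \bar R.
  by apply: integral_ge0 => p _.
move=> /(_ h); apply: filterS => q Iq.
pose S := (fun p => consp (thead q, p)) @^-1` N.
have mS : measurable S.
  rewrite -[X in measurable X]setTI.
  by apply: (measurableT_comp (@measurable_consp _ E k)) => //; exact: measurable_fun_pair.
exists S; split => //.
- by rewrite -Iq -[S]setIT -integral_indic.
- by move=> p Np; apply: sub.
Qed.

End PowerFubini.

Lemma ae_density d (T : measurableType d) (R : realType)
    (m : {measure set T -> \bar R}) (f : T -> R) (Phi : T -> Prop) :
  measurable_fun setT f -> (forall x, 0 <= f x) ->
  {ae m, forall x, 0 < f x -> Phi x} ->
  {ae density_measure m f, forall x, Phi x}.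
Proof.
move=> mf f0 [N [mN N0 sub]].
have mf0 : measurable (f @^-1` [set 0]).
  by rewrite -[X in measurable X]setTI; apply: mf => //; exact: measurable_set1.
have h1 : (density_measure m f).-negligible N.
  exists N; split => //; rewrite /density_measure null_set_integral//.
  by apply/measurable_EFinP; exact: measurable_funTS.
have h2 : (density_measure m f).-negligible (f @^-1` [set 0]).
  by exists (f @^-1` [set 0]); split => //; apply: integral0_eq => x /= ->.
apply: negligibleS (negligibleU h1 h2) => //.
move=> x /= nP.
case: (eqVneq (f x) 0) => fx; first by right.
left; apply: sub => /= h; apply: nP; apply: h.
by rewrite lt_neqAle eq_sym fx f0.
Qed.

(** * Simple processes and null diagonals *)

Lemma fsum_finType (R : realType) (T : finType) (F : T -> \bar R) :
  (\sum_(i \in [set: T]) F i = \sum_i F i)%E.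
Proof.
rewrite (@fsbigE _ _ _ _ _ (index_enum T)).
- by apply: eq_bigl => i; rewrite in_setT.
- exact: index_enum_uniq.
- by [].
- by move=> i _; rewrite mem_index_enum.
Qed.

(** A box with multiplicities is described by its list [s] of labels: the
    coordinate [i] lies in the set [A (tnth s i)]. *)
Lemma power_box_label d (R : realType) (E : borelMetricType d R) k j
    (l : 'I_j -> nat) : (\sum_(a < j) l a)%N = k ->
  exists2 s : k.-tuple 'I_j, (forall a, count_mem a s = l a) &
    forall A : 'I_j -> set E, power_box A l = box (fun i : 'I_k => A (tnth s i)).
Proof.
move=> lk; pose s := flatten [seq nseq (l a) a | a <- enum 'I_j].
have sz : size s == k.
  rewrite size_flatten /shape -map_comp -lk sumnE big_map big_enum /=.
  by apply/eqP; apply: eq_bigr => a _; rewrite /= size_nseq.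
exists (Tuple sz) => [a|A] /=.
  rewrite count_flatten -map_comp sumnE big_map big_enum /= (bigD1 a)//= count_nseq /= eqxx mul1n.
  by rewrite big1 ?addn0// => b /negbTE ba; rewrite count_nseq /= ba.
have nthA (i : 'I_k) : nth set0 (flatten [seq nseq (l a) (A a) | a <- enum 'I_j]) i =
    A (tnth (Tuple sz) i).
  rewrite (_ : flatten _ = map A s); last first.
    by rewrite map_flatten -map_comp; congr flatten; apply: eq_map => a /=; rewrite map_nseq.
  set a0 := tnth (Tuple sz) i.
  rewrite (nth_map a0) ?(eqP sz)//; congr A; exact/esym/tnth_nth.
by apply/seteqP; split => x xA i; have := xA i; rewrite nthA.
Qed.

Section Correlation.
Context d (R : realType) (E : borelMetricType d R).
Variables (mu : {sigma_finite_measure set E -> \bar R}) (P : probability (conf E) R).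
Variables (k : nat) (rho : k.-tuple E -> R).
Hypothesis rhoP : correlation_function mu P rho.
Local Open Scope ereal_scope.

Lemma corr_box (B : 'I_k -> set E) : (forall i, measurable (B i)) ->
  (forall i, metric_bounded (B i)) -> trivIset setT B ->
  \int[P]_X (conf_prod X B)%:R%:E = density_measure (mpow mu k) rho (box B).
Proof.
move=> mB bB tB; case: rhoP => _ _ _ /(_ k B (fun=> 1%N)) h.
rewrite /density_measure -[in RHS](_ : power_box B (fun=> 1%N) = box B); last first.
  have fl (t : seq 'I_k) : flatten [seq nseq 1 (B a) | a <- t] = map B t.
    by elim: t => //= a t ->.
  rewrite /power_box fl.
  by apply/seteqP; split => x xB i; have := xB i;
    rewrite (nth_map i) ?size_enum_ord ?nth_ord_enum.
rewrite h//; last by rewrite sum1_card card_ord.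
by apply: eq_integral => X _; under eq_bigr do rewrite ffactn1.
Qed.

Lemma corr_local_finite (D : set E) : measurable D -> metric_bounded D ->
  density_measure (mpow mu k) rho (box (fun=> D)) < +oo.
Proof.
move=> mD bD; case: rhoP => mr r0 /(_ D mD bD) /integrableP[_].
by under eq_integral do rewrite gee0_abs ?lee_fin//.
Qed.

Lemma corr_power (D : set E) : (0 < k)%N -> measurable D -> metric_bounded D ->
  \int[P]_X (conf_count X D ^_ k)%:R%:E = density_measure (mpow mu k) rho (box (fun=> D)).
Proof.
move=> k0 mD bD; case: rhoP => _ _ _ /(_ 1%N (fun=> D) (fun=> k)) h.
rewrite /density_measure -[in RHS](_ : power_box (fun=> D) (fun _ : 'I_1 => k) = box (fun=> D)); last first.
  have [s _ ->] := @power_box_label _ _ E k 1 (fun=> k) (big_ord1 _ _).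
  by [].
rewrite h//; first by apply: eq_integral => X _; rewrite big_ord1.
- by move=> a b _ _ _; rewrite !ord1.
- by rewrite big_ord1.
Qed.

End Correlation.

Section Simple.
Context d (R : realType) (E : borelMetricType d R).
Hypothesis properE : forall B : set E, metric_bounded B -> precompact B.
Variables (c : nat -> E) (r : nat -> R).
Hypothesis cr : ball_base c r.
Notation code := (ball_code c r).
Notation cell := (ball_cell c r).
Variables (mu : {sigma_finite_measure set E -> \bar R}) (P : probability (conf E) R).
Local Open Scope ereal_scope.

Lemma measurable_cell_simple z (D : set E) n : measurable D -> metric_bounded D ->
  measurable [set X : conf E | cell_simple c r z D n X].
Proof.
move=> mD bD.
rewrite (_ : [set X | _] = \bigcap_(b in [set: n.-tuple bool])
   [set X : conf E | (conf_count X (D `&` cell n b) <= (b \notin map (code n) z))%N]).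
  apply: fin_bigcap_measurable => [|b _]; first exact: finite_finset.
  rewrite -[X in measurable X]setTI.
  apply: (@measurable_nat_comp _ _ R (fun X => conf_count X (D `&` cell n b)) _ _
    (fun m => (m <= (b \notin map (code n) z))%N) _ measurableT [set true]) => //.
  apply: (measurable_conf_count properE cr).
    by apply: measurableI => //; exact: measurable_cell.
  by apply: metric_bounded_sub bD; exact: subIsetl.
by apply/seteqP; split => [X sX b _|X sX b]; exact: sX.
Qed.

(** If [X] is not cell-simple at level [n], some cell contains two of its
    points. By Markov's inequality, the probability of this is at most the
    expected number of ordered pairs of points of [X] in a common cell, i.e.
    the integral of [rho] over the pairs with equal codes. These pairs
    decrease to the diagonal, where [rho] vanishes. *)
Lemma cell_simple_ae (rho : 2.-tuple E -> R) (D : set E) :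
  correlation_function mu P rho ->
  {ae mpow mu 2, forall x, tnth x ord0 = tnth x ord_max -> rho x = 0%R} ->
  measurable D -> metric_bounded D ->
  {ae P, forall X, exists n, cell_simple c r [::] D n X}.
Proof.
move=> rhoP diag mD bD; have [mr r0 _ _] := rhoP.
pose lam := density_measure (mpow mu 2) rho.
pose Bx n (b : n.-tuple bool) : set (2.-tuple E) := box (fun=> D `&` cell n b).
have mDc n b : measurable (D `&` cell n b).
  by apply: measurableI => //; exact: measurable_cell.
have bDc n b : metric_bounded (D `&` cell n b).
  by apply: metric_bounded_sub bD; exact: subIsetl.
have mBx n b : measurable (@Bx n b) by exact: measurable_box.
pose T n := \bigcup_(b in [set: n.-tuple bool]) Bx n b.
have mT n : measurable (T n).
  by apply: fin_bigcup_measurable => [|b _]; [exact: finite_finset|exact: mBx].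
have TE n : T n = box (fun=> D) `&` [set x | code n (tnth x ord0) = code n (tnth x ord_max)].
  apply/seteqP; split => [x [b _ xb]|x [xD xc]].
    by split => [i|/=]; [have [] := xb i|have [_ ->] := xb ord0; have [_ ->] := xb ord_max].
  exists (code n (tnth x ord0)) => // i; split; first exact: xD.
  case: (unliftP ord0 i) => [j ->|-> //]; rewrite /cell /= xc.
  by congr (ball_code c r n (tnth x _)); apply: val_inj; rewrite /= (ord1 j).
have lamT n : lam (T n) = \int[P]_X (\sum_(b : n.-tuple bool)
    (conf_count X (D `&` cell n b) ^_ 2)%:R%:E).
  rewrite ge0_integral_sum//; last first.
    move=> b; apply/measurable_EFinP.
    apply: (@measurable_nat_comp _ _ R (fun X => conf_count X (D `&` cell n b)) _ _
      (fun m => (m ^_ 2)%:R : R)).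
    exact: (measurable_conf_count properE cr).
  rewrite /lam /T measure_fin_bigcup//; last 2 first.
  - exact: finite_finset.
  - move=> b b' _ _ [x [xb xb']].
    by have [_ <-] := xb ord0; have [_ <-] := xb' ord0.
  rewrite fsum_finType.
  by apply: eq_bigr => b _; rewrite (corr_power rhoP).
have mNS n : measurable (~` [set X : conf E | cell_simple c r [::] D n X]).
  by apply: measurableC; exact: measurable_cell_simple.
have PNS n : P (~` [set X : conf E | cell_simple c r [::] D n X]) <= lam (T n).
  rewrite lamT -[X in P X]setIT -integral_indic//.
  apply: ge0_le_integral => //.
  - exact/measurable_EFinP.
  - apply: emeasurable_sum => b; apply/measurable_EFinP.
    apply: (@measurable_nat_comp _ _ R (fun X => conf_count X (D `&` cell n b)) _ _
      (fun m => (m ^_ 2)%:R : R)).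
    exact: (measurable_conf_count properE cr).
  move=> X _; rewrite indicE.
  have t0 (b : n.-tuple bool) :
      0 <= (conf_count X (D `&` cell n b) ^_ 2)%:R%:E :> \bar R.
    by rewrite lee_fin.
  case: (pselect (cell_simple c r [::] D n X)) => [sX|NsX].
    by rewrite memNset ?sume_ge0// => /(_ sX).
  rewrite mem_set//; move/existsNP : NsX => [b /negP].
  rewrite -ltnNge /= => Nb; rewrite (bigD1 b)//=.
  apply: (@le_trans _ _ (conf_count X (D `&` cell n b) ^_ 2)%:R%:E).
    by rewrite lee_fin ler1n ffact_gt0.
  by rewrite leeDl// sume_ge0.
have lam0 : lam (\bigcap_n T n) = 0.
  have mW : measurable (\bigcap_n T n) by exact: bigcapT_measurable.
  rewrite /lam /density_measure.
  rewrite -(integral0 (mpow mu 2) (\bigcap_n T n)).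
  apply: ge0_ae_eq_integral => //.
  - by apply/measurable_EFinP; exact: measurable_funTS.
  - by move=> x _; rewrite lee_fin.
  apply: filterS diag => x h Tx; congr EFin; apply: h.
  apply/eqP/negPn/negP => /(code_sep cr)[n]; apply/negP; rewrite negbK; apply/eqP.
  by have := Tx n I; rewrite TE => -[].
have cvT : lam (T n) @[n --> \oo] --> 0.
  rewrite -lam0 /lam; apply: nonincreasing_cvg_mu => //.
  - apply: le_lt_trans (corr_local_finite rhoP mD bD).
    by apply: le_measure => //; rewrite ?inE//; [exact: measurable_box|rewrite TE; exact: subIsetl].
  - exact: bigcapT_measurable.
  move=> m n mn; apply/subsetPset; rewrite !TE => x [xD xc]; split => //.
  exact: code_le xc.
exists (\bigcap_n ~` [set X : conf E | cell_simple c r [::] D n X]); split.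
- exact: bigcapT_measurable.
- apply/eqP; rewrite eq_le measure_ge0 andbT.
  apply: (cvge_to_ge cvT); apply: nearW => n.
  apply: le_trans (PNS n); apply: le_measure; rewrite ?inE//.
    exact: bigcapT_measurable.
  exact: bigcap_inf.
- by move=> X /= h n _ sX; apply: h; exists n.
Qed.

Lemma measurable_uniq_tuple k (z : seq E) :
  measurable [set x : k.-tuple E | uniq x && all (fun y => y \notin z) x].
Proof.
have mC n : measurable [set x : k.-tuple E | codes_distinct c r n z x].
  rewrite (_ : [set x | _] = \bigcup_(b in [set b : k.-tuple (n.-tuple bool) |
      uniq b && all (fun x => x \notin map (code n) z) b])
      box (fun i => cell n (tnth b i))).
    apply: fin_bigcup_measurable => [|b _]; first exact: finite_finset.
    by apply: measurable_box => i; exact: measurable_cell.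
  apply/seteqP; split => [x xd|x [b bok xb]].
    exists [tuple of map (code n) x] => //.
    by move=> i; rewrite tnth_map.
  rewrite /= /codes_distinct (_ : map _ x = tval b) //.
  suff -> : b = [tuple of map (code n) x] by [].
  by apply: eq_from_tnth => i; rewrite tnth_map; exact/esym/xb.
rewrite (_ : [set x | _] = \bigcup_n [set x : k.-tuple E | codes_distinct c r n z x]).
  exact: bigcupT_measurable.
apply/seteqP; split => [x /andP[ux zx]|x [n _ /codes_distinct_uniq[ux zx]]].
  by have [n hn] := codes_distinct_ex cr ux zx; exists n.
by rewrite /= ux zx.
Qed.

Lemma cells_trivIset n k (A : 'I_k -> set E) (b : k.-tuple (n.-tuple bool)) :
  uniq b -> trivIset setT (fun i => A i `&` cell n (tnth b i)).
Proof.
move=> /tuple_uniqP ub i j _ _ [x [[_ xi] [_ xj]]].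
by apply: ub; rewrite -xi -xj.
Qed.

(** The [k]-th factorial moment of the count of [D] is the integral of [rho]
    over the whole box by definition, and over the tuples without repetition
    by [factorial_moment]. It is finite, so the difference is zero. *)
Lemma corr_diag_null k (rho : k.-tuple E -> R) (D : set E) : (0 < k)%N ->
  correlation_function mu P rho -> measurable D -> metric_bounded D ->
  {ae P, forall X, exists n, cell_simple c r [::] D n X} ->
  density_measure (mpow mu k) rho (box (fun=> D) `&` ~` [set x | uniq x]) = 0.
Proof.
move=> k0 rhoP mD bD Ps; have [mr r0 _ _] := rhoP.
have mbD : measurable (box (fun _ : 'I_k => D)) by exact: measurable_box.
have mU : measurable [set x : k.-tuple E | uniq x].
  have := @measurable_uniq_tuple k [::]; congr measurable.
  by apply/seteqP; split => x /=; rewrite all_predT andbT.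
have tD : trivIset setT (fun _ : 'I_1 => D) by move=> a b _ _ _; rewrite !ord1.
have := @factorial_moment _ _ _ properE _ _ cr P D bD 'I_1 (fun=> D)
  (fun=> mD) (fun _ => @subset_refl _ D) tD k (nseq_tuple k ord0) [::]
  (density_measure (mpow mu k) rho) Ps.
have h n (b : k.-tuple (n.-tuple bool)) : uniq b ->
    all (fun x => x \notin map (code n) [::]) b ->
    \int[P]_X (conf_prod X (fun i => D `&` cell n (tnth b i)))%:R%:E =
    density_measure (mpow mu k) rho (box (fun i => D `&` cell n (tnth b i))).
  move=> ub _; apply: (corr_box rhoP) => [i|i|].
  - by apply: measurableI => //; exact: measurable_cell.
  - by apply: metric_bounded_sub bD; exact: subIsetl.
  - exact: (@cells_trivIset n k (fun=> D)).
move=> /(_ mr r0 h).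
under eq_integral => X _.
  rewrite big_ord1 (_ : count_mem ord0 _ = k); last first.
    by rewrite /= count_nseq /= mul1n.
  over.
rewrite (corr_power rhoP)//.
rewrite (_ : [set x | _ && _] = [set x | uniq x]); last first.
  by apply/seteqP; split => x /=; rewrite all_predT andbT.
rewrite -[in LHS](setIT (box _)) -(setUv [set x : k.-tuple E | uniq x]) setIUr.
rewrite measureU//; last 3 first.
- exact: measurableI.
- by apply: measurableI => //; exact: measurableC.
- by rewrite setIACA setICr setI0.
have fin := corr_local_finite rhoP mD bD.
have fU : density_measure (mpow mu k) rho (box (fun=> D) `&` [set x | uniq x]) \is a fin_num.
  rewrite ge0_fin_numE; last by apply: integral_ge0 => x _; rewrite lee_fin.
  apply: le_lt_trans fin.
  apply: le_measure => //; rewrite ?inE//; first exact: measurableI.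
move=> /(congr1 (fun t => t - density_measure (mpow mu k) rho (box (fun=> D) `&` [set x | uniq x]))).
by rewrite addeAC subee// add0e.
Qed.

Lemma corr_uniq k (rho : k.-tuple E -> R) (x0 : E) : (0 < k)%N ->
  correlation_function mu P rho ->
  (forall m : nat, {ae P, forall X, exists n,
     cell_simple c r [::] (ball x0 m%:R) n X}) ->
  {ae mpow mu k, forall x, rho x <> 0%R -> uniq x}.
Proof.
move=> k0 rhoP Ps; have [mr r0 _ _] := rhoP.
have mU : measurable [set x : k.-tuple E | uniq x].
  have := @measurable_uniq_tuple k [::]; congr measurable.
  by apply/seteqP; split => x /=; rewrite all_predT andbT.
have h (m : nat) : {ae mpow mu k, forall x,
    (box (fun=> ball x0 m%:R) `&` ~` [set x | uniq x]) x -> rho x = 0%R}.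
  have mb := measurable_mball x0 (m%:R : R).
  have mW : measurable (box (fun _ : 'I_k => ball x0 (m%:R : R)) `&` ~` [set x | uniq x]).
    by apply: measurableI; [exact: measurable_box|exact: measurableC].
  have := corr_diag_null k0 rhoP mb (bounded_mball _ _) (Ps m).
  rewrite /density_measure => I0.
  have /(ae_eq_integral_abs _ mW) : \int[mpow mu k]_(x in
      box (fun _ : 'I_k => ball x0 (m%:R : R)) `&` ~` [set x | uniq x]) `|(rho x)%:E| = 0.
    by under eq_integral do rewrite gee0_abs ?lee_fin//.
  move=> /(_ (measurable_funTS _)) hh.
  have : measurable_fun setT (fun x => (rho x)%:E : \bar R) by exact/measurable_EFinP.
  by move=> /hh; apply: filterS => x hx Wx; have [] := hx Wx.
apply: filterS (ae_foralln h) => x hx rx; apply: contrapT => nux.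
have [m hm] : exists m : nat, forall i, ball x0 (m%:R : R) (tnth x i).
  have /choice[g hg] : forall i : 'I_k, exists m : nat, ball x0 (m%:R : R) (tnth x i).
    by move=> i; exact: mball_nat_cover.
  exists (\max_i g i)%N => i; apply: mball_nat_mono (hg i).
  exact: leq_bigmax.
by apply: rx; apply: (hx m).
Qed.

End Simple.

(** * Palm measures and moments *)

Section ProbabilityKernelIntegral.
Context d d' (X : measurableType d) (Y : measurableType d') (R : realType).
Variable l : X -> probability Y R.
Hypothesis ml : forall U, measurable U -> measurable_fun setT (fun x => l x U).

(** The family under a name of its own, to which the kernel structures are
    attached. *)
Definition prob_family (x : X) : {measure set Y -> \bar R} := l x.

HB.instance Definition _ := isKernel.Build _ _ _ _ _ prob_family ml.
HB.instance Definition _ := Kernel_isProbability.Build _ _ _ _ _ prob_family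
  (fun x => probability_setT (l x)).

Lemma measurable_fun_prob_integral (f : X * Y -> \bar R) :
  measurable_fun setT f -> (forall z, (0 <= f z)%E) ->
  measurable_fun setT (fun x => \int[l x]_y f (x, y))%E.
Proof.
move=> mf f0.
exact: (@measurable_fun_integral_finite_kernel _ _ _ _ _ f prob_family).
Qed.

End ProbabilityKernelIntegral.

Section NullSupport.
Import HBNNSimple.

(** Meant for functions of unknown measurability, such as a sum over the
    points of a configuration. The simple functions below [f] vanish outside
    [N]. *)
Lemma integral_null_support d (T : measurableType d) (R : realType)
    (m : {measure set T -> \bar R}) (f : T -> \bar R) (N : set T) :
  (forall x, (0 <= f x)%E) -> measurable N -> m N = 0%E ->
  (forall x, ~ N x -> f x = 0%E) -> (\int[m]_x f x = 0)%E.
Proof.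
move=> f0 mN N0 fN; rewrite ge0_integralTE//.
apply/eqP; rewrite eq_le; apply/andP; split; last first.
  by rewrite -ge0_integralTE//; apply: integral_ge0.
apply: ge_ereal_sup => _ [h /= hf <-].
rewrite -integralT_nnsfun (ge0_ae_eq_integral (g := cst 0%E))// ?integral0//.
- exact/measurable_EFinP.
- by move=> x _; rewrite lee_fin.
exists N; split => // x /= hx; apply: contrapT => Nx; apply: hx => _.
apply/eqP; rewrite eq_le; apply/andP; split; last by rewrite lee_fin.
by rewrite /= -(fN x Nx); exact: hf.
Qed.

End NullSupport.

Section AddPoint.
Context d (R : realType) (E : borelMetricType d R).
Local Open Scope ereal_scope.

Lemma conf_count_add (X : conf E) (q : 1.-tuple E) (A : set E) : metric_bounded A ->
  conf_count (conf_add X q) A = (conf_count X A + (thead q \in A))%N.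
Proof.
move=> bA; apply/eqP; rewrite -(eqr_nat R) -eqe natrD EFinD -!confmE//.
rewrite /confm /=; apply/eqP.
transitivity (\esum_(x in A) ((mult X x)%:R%:E + (count_mem x q)%:R%:E) : \bar R).
  by apply: eq_esum => x _; rewrite natrD EFinD.
rewrite esumD//; congr (_ + _).
rewrite esum_mkcond (_ : (fun _ => _) = fun x => if x \in [set thead q] `&` A then 1 else 0).
  rewrite -esum_mkcond; case: (boolP (thead q \in A)) => qA.
    rewrite (_ : _ `&` _ = [set thead q]) ?esum_set1//.
    by apply/setIidl => x ->; exact: set_mem.
  rewrite (_ : _ `&` _ = set0) ?esum_set0//.
  by apply/seteqP; split => // x [-> /mem_set]; rewrite (negbTE qA).
apply/funext => x; rewrite in_setI andbC; case: (x \in A) => //=.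
case: (tupleP q) => y t; rewrite (tuple0 t) theadE /= addn0 eq_sym.
have -> : (x \in [set y]) = (x == y).
  by apply/idP/eqP => [/set_mem//|->]; exact: mem_set.
by case: eqP.
Qed.

Variables (c : nat -> E) (r : nat -> R).

Lemma cell_simple_mult (D : set E) n (X : conf E) x : metric_bounded D -> D x ->
  cell_simple c r [::] D n X -> (mult X x <= 1)%N.
Proof.
move=> bD Dx /(_ (ball_code c r n x)); apply: leq_trans.
rewrite (conf_countE X bD (@subIsetl _ D _)).
case: (eqVneq (mult X x) 0%N) => [->//|x0].
rewrite big_mkcond (bigD1_seq x) ?conf_supp_uniq//=.
  by rewrite mem_set ?leq_addr.
by rewrite mem_conf_supp// mem_set.
Qed.

(** The Palm formula sums over points regardless of their multiplicity,
    whereas counts include it; the two agree on simple configurations. *)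
Lemma esum_points (X : conf E) (D B : set E) n (C : nat) : metric_bounded D ->
  B `<=` D -> cell_simple c r [::] D n X ->
  \esum_(q in [set q : 1.-tuple E | uniq q /\ forall i, mult X (tnth q i) != 0%N])
     ((thead q \in B)%:R * C%:R)%:E = (conf_count X B * C)%:R%:E :> \bar R.
Proof.
move=> bD BD sX.
have bB : metric_bounded B := metric_bounded_sub BD bD.
rewrite (@reindex_esum _ _ _ [set x | mult X x != 0%N] _ (fun x => [tuple x])); last first.
  split.
  - by move=> x /= x0; split => // i; rewrite (ord1 i) tnth0.
  - by move=> x y _ _ /(congr1 (fun t => thead t)); rewrite !theadE.
  - move=> q [_ qX]; exists (thead q); first exact: qX.
    by apply: eq_from_tnth => i; rewrite (ord1 i) tnth0.
rewrite esum_mkcond.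
rewrite (_ : (fun _ => _) = fun x => if x \in [set` conf_supp X B] then C%:R%:E else 0); last first.
  apply/funext => x; rewrite theadE.
  have -> : (x \in [set` conf_supp X B]) = (x \in conf_supp X B).
    by apply/idP/idP; rewrite inE.
  rewrite mem_conf_supp// andbC.
  have -> : (x \in [set x | mult X x != 0%N]) = (mult X x != 0%N).
    by apply/idP/idP; rewrite inE.
  by case: (mult X x != 0%N) => //=; case: (x \in B); rewrite ?mul1r ?mul0r.
rewrite -esum_mkcond esum_fset; [|exact: finite_seq|by move=> x _; rewrite lee_fin].
rewrite -fsbig_seq ?conf_supp_uniq// sumEFin.
congr EFin; rewrite natrM (conf_countE X bB (@subset_refl _ B)) natr_sum.
rewrite [in RHS]big_mkcond big_distrl /= big_seq [RHS]big_seq.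
apply: eq_bigr => x; rewrite mem_conf_supp// => /andP[xB x0].
have := cell_simple_mult bD (BD _ (set_mem xB)) sX.
by case: (mult X x) x0 => // -[|//]; rewrite xB mul1r.
Qed.

End AddPoint.

Section SectionMass.
Context d (R : realType) (E : borelMetricType d R).
Variable mu : {sigma_finite_measure set E -> \bar R}.
Variables (k : nat) (rho : k.+1.-tuple E -> R).
Hypotheses (mr : measurable_fun setT rho) (r0 : forall x, 0 <= rho x).
Variable A : 'I_k -> set E.
Hypotheses (mA : forall i, measurable (A i)).
Local Open Scope ereal_scope.

(** The box of these sets is the product of [B] and the box of [A]
    ([box_cons]). *)
Definition cons_sets (B : set E) (i : 'I_k.+1) : set E :=
  if unlift ord0 i is Some j then A j else B.

Lemma box_cons (B : set E) (q : 1.-tuple E) (p : k.-tuple E) :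
  box (cons_sets B) (consp (thead q, p)) <-> B (thead q) /\ box A p.
Proof.
split=> [h|[Bq hA] i].
  split; first by have := h ord0; rewrite /cons_sets unlift_none.
  by move=> i; have := h (lift ord0 i); rewrite /cons_sets liftK tnthS.
rewrite /cons_sets; case: (unliftP ord0 i) => [j ->|-> //]; rewrite tnthS; exact: hA.
Qed.

Definition section_mass (q : 1.-tuple E) :=
  \int[mpow mu k]_(p in box A) (rho (consp (thead q, p)))%:E.

Lemma section_mass_ge0 q : 0 <= section_mass q.
Proof. by apply: integral_ge0 => p _; rewrite lee_fin. Qed.

Lemma measurable_consp_section (q : 1.-tuple E) :
  measurable_fun setT (fun p : k.-tuple E => consp (thead q, p)).
Proof. exact: (measurableT_comp (@measurable_consp _ E k) (pair1_measurable _)). Qed.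

Let mbox B : measurable B -> measurable (box (cons_sets B)).
Proof. by move=> mB; apply: measurable_box => i; rewrite /cons_sets; case: unliftP. Qed.

Let rpatch B := (fun x => (rho x)%:E) \_ (box (cons_sets B)).

Let mrpatch B : measurable B -> measurable_fun setT (rpatch B).
Proof.
move=> mB; apply/(measurable_restrictT _ _).1; first exact: mbox.
by apply/measurable_EFinP; exact: measurable_funTS.
Qed.

Let rpatch_ge0 B y : 0 <= rpatch B y.
Proof. by apply: erestrict_ge0 => {}y _; rewrite lee_fin. Qed.

Let rpatchE B q : \int[mpow mu k]_p rpatch B (consp (thead q, p)) =
  (section_mass \_ (@thead _ E @^-1` B)) q.
Proof.
rewrite patchE; case: ifPn => [/set_mem Bq|/negP nBq].
  rewrite /section_mass [RHS]integral_mkcond; apply: eq_integral => p _.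
  rewrite /rpatch !patchE; congr (if _ then _ else _).
  by apply/idP/idP => /set_mem h; apply/mem_set; [case/box_cons: h|apply/box_cons].
rewrite integral0_eq// => p _; rewrite /rpatch patchE memNset// => /box_cons[Bq _].
by apply: nBq; exact: mem_set.
Qed.

Lemma measurable_section_mass : measurable_fun setT section_mass.
Proof.
rewrite (_ : section_mass = fun q => \int[mpow mu k]_p rpatch setT (consp (thead q, p))).
  by apply: measurable_split_integral => //; exact: mrpatch.
by apply/funext => q; rewrite rpatchE patchE mem_set.
Qed.

Lemma integral_section_mass (B : set E) : measurable B ->
  \int[mpow mu 1]_(q in @thead _ E @^-1` B) section_mass q =
  density_measure (mpow mu k.+1) rho (box (cons_sets B)).
Proof.
move=> mB; rewrite /density_measure [RHS]integral_mkcond integral_mpow_split//.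
  by rewrite integral_mkcond; apply: eq_integral => q _; rewrite -rpatchE.
  exact: mrpatch.
by move=> y; exact: rpatch_ge0.
Qed.

End SectionMass.

Section PalmMoments.
Context d (R : realType) (E : borelMetricType d R).
Hypothesis properE : forall B : set E, metric_bounded B -> precompact B.
Variables (c : nat -> E) (r : nat -> R).
Hypothesis cr : ball_base c r.
Notation code := (ball_code c r).
Notation cell := (ball_cell c r).
Variables (mu : {sigma_finite_measure set E -> \bar R}) (P : probability (conf E) R).
Variable rho1 : 1.-tuple E -> R.
Hypotheses (mrho1 : measurable_fun setT rho1) (rho1_ge0 : forall q, 0 <= rho1 q).
Variable palm : 1.-tuple E -> probability (conf E) R.
Hypothesis palmP : reduced_palm mu P rho1 palm.
Local Open Scope ereal_scope.

Let mpalm U : measurable U -> measurable_fun setT (fun q => palm q U).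
Proof. by case: palmP => h _; exact: h. Qed.

Lemma palm_formula (u : conf E * 1.-tuple E -> R) :
  measurable_fun setT u -> (forall z, (0 <= u z)%R) ->
  measurable_fun setT (fun z : 1.-tuple E * conf E => u (conf_add z.2 z.1, z.1)) ->
  \int[P]_X (\esum_(q in [set q : 1.-tuple E |
      uniq q /\ forall i, mult X (tnth q i) != 0%N]) (u (X, q))%:E) =
  \int[mpow mu 1]_q ((\int[palm q]_X (u (conf_add X q, q))%:E) * (rho1 q)%:E).
Proof.
move=> mu_ u0 muj; rewrite palmP.2//.
rewrite -[LHS]/(\int[density_measure (mpow mu 1) rho1]_q
  \int[palm q]_X (u (conf_add X q, q))%:E).
rewrite integral_density_measure//.
- apply: (@measurable_fun_prob_integral _ _ _ _ _ palm mpalm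
    (fun z => (u (conf_add z.2 z.1, z.1))%:E)) => //.
    exact/measurable_EFinP.
  by move=> z; rewrite lee_fin.
- by move=> q; apply: integral_ge0 => X _; rewrite lee_fin.
Qed.

Variable D : set E.
Hypotheses (mD : measurable D) (bD : metric_bounded D).

Definition simple_on : set (conf E) := [set X | exists n, cell_simple c r [::] D n X].

Lemma measurable_simple_on : measurable simple_on.
Proof.
rewrite (_ : simple_on = \bigcup_n [set X | cell_simple c r [::] D n X]).
  by apply: bigcupT_measurable => n; exact: (measurable_cell_simple properE cr).
by apply/seteqP; split => [X [n sX]|X [n _ sX]]; exists n.
Qed.

Lemma measurable_count_add (A : set E) : measurable A -> metric_bounded A ->
  measurable_fun setT (fun z : 1.-tuple E * conf E =>
    (conf_count (conf_add z.2 z.1) A)%:R : R).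
Proof.
move=> mA bA; under eq_fun do rewrite conf_count_add// natrD.
apply: measurable_funD.
  exact: (measurableT_comp (measurable_conf_count properE cr mA bA) measurable_snd).
rewrite (_ : (fun _ => _) = (\1_A \o @thead _ E) \o fst).
  apply: measurableT_comp; last exact: measurable_fst.
  by apply: measurableT_comp; [exact: measurable_indic|exact: measurable_thead].
by apply/funext => z; rewrite /= indicE.
Qed.

Lemma measurable_simple_on_add :
  measurable [set z : 1.-tuple E * conf E | simple_on (conf_add z.2 z.1)].
Proof.
rewrite (_ : [set z | _] = \bigcup_n \bigcap_(b in [set: n.-tuple bool])
   [set z | (conf_count (conf_add z.2 z.1) (D `&` cell n b) <= 1)%N]).
  apply: bigcupT_measurable => n.
  apply: fin_bigcap_measurable => [|b _]; first exact: finite_finset.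
  rewrite -[X in measurable X]setTI.
  apply: (@measurable_nat_comp _ _ R (fun z : 1.-tuple E * conf E =>
    conf_count (conf_add z.2 z.1) (D `&` cell n b)) _ _
    (fun m => (m <= 1)%N) _ measurableT [set true]) => //.
  apply: measurable_count_add.
    by apply: measurableI => //; exact: measurable_cell.
  by apply: metric_bounded_sub bD; exact: subIsetl.
by apply/seteqP; split => [z [n sX]|z [n _ sX]]; exists n => // b; have := sX b; [|apply].
Qed.

Hypothesis P_simple : {ae P, forall X, simple_on X}.

(** In the Palm formula for the indicator of the configurations that are not
    simple, the side of [P] is zero. *)
Lemma palm_simple_ae :
  {ae mpow mu 1, forall q, (0 < rho1 q)%R ->
    {ae palm q, forall X, simple_on (conf_add X q)}}.
Proof.
have mNS := measurableC measurable_simple_on.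
pose u (z : conf E * 1.-tuple E) : R := \1_(~` simple_on) z.1.
have mI : measurable_fun setT (\1_(~` simple_on) : conf E -> R).
  exact: measurable_indic.
have mu_ : measurable_fun setT u by exact: (measurableT_comp mI measurable_fst).
have u0 z : (0 <= u z)%R by rewrite /u indicE.
pose NSa := ~` [set z : 1.-tuple E * conf E | simple_on (conf_add z.2 z.1)].
have muj : measurable_fun setT (fun z : 1.-tuple E * conf E => u (conf_add z.2 z.1, z.1)).
  rewrite (_ : (fun _ => _) = \1_NSa).
    by apply: measurable_indic; apply: measurableC; exact: measurable_simple_on_add.
  by apply/funext => z; rewrite /u !indicE !in_setC; congr (~~ _)%:R; apply/idP/idP; rewrite !inE.
have := palm_formula mu_ u0 muj.
have [N [mN N0 subN]] := P_simple.
rewrite (integral_null_support (N := N))//; first last.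
- move=> X NX; apply: esum1 => q _; rewrite /u /= indicE memNset//= => nX.
  by apply: NX; exact: subN.
- by move=> X; apply: esum_ge0 => q _; rewrite lee_fin.
move=> /esym.
have mint : measurable_fun setT (fun q => \int[palm q]_X (u (conf_add X q, q))%:E).
  apply: (@measurable_fun_prob_integral _ _ _ _ _ palm mpalm
    (fun z => (u (conf_add z.2 z.1, z.1))%:E)) => //.
    exact/measurable_EFinP.
  by move=> z; rewrite lee_fin.
have int0 q : 0 <= \int[palm q]_X (u (conf_add X q, q))%:E.
  by apply: integral_ge0 => X _; rewrite lee_fin.
move=> I0.
have mrE : measurable_fun setT (fun q => (rho1 q)%:E) by exact/measurable_EFinP.
have p0 (q : 1.-tuple E) : 0 <= (\int[palm q]_X (u (conf_add X q, q))%:E) * (rho1 q)%:E.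
  by rewrite mule_ge0// lee_fin.
have := ae_integral0 (emeasurable_funM mint mrE) p0 I0.
apply: filterS => q /eqP; rewrite mule_eq0 => /orP[/eqP Iq _|]; last first.
  by rewrite eqe => /eqP -> /=; rewrite ltxx.
have mq : measurable_fun setT (fun X => (u (conf_add X q, q))%:E).
  by apply/measurable_EFinP; exact: (measurableT_comp muj (pair1_measurable _)).
have uq0 X : 0 <= (u (conf_add X q, q))%:E by rewrite lee_fin.
have := ae_integral0 mq uq0 Iq; apply: filterS => X.
rewrite /u /= indicE => -[] /eqP; rewrite pnatr_eq0 eqb0 => /negP nX.
by apply: contrapT => h; apply: nX; apply: mem_set.
Qed.

Section Moments.
Variables (k : nat) (rho : k.+1.-tuple E -> R).
Hypothesis rhoP : correlation_function mu P rho.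
Variable A : 'I_k -> set E.
Hypotheses (mA : forall i, measurable (A i)) (bA : forall i, metric_bounded (A i)).
Hypothesis tA : trivIset setT A.

Notation consA := (cons_sets A).

Let conf_prod_cons (B : set E) X : conf_prod X (consA B) = (conf_count X B * conf_prod X A)%N.
Proof.
rewrite /conf_prod big_ord_recl /cons_sets unlift_none; congr muln.
by apply: eq_bigr => i _; rewrite liftK.
Qed.

Definition palm_moment (q : 1.-tuple E) := \int[palm q]_X (conf_prod X A)%:R%:E.

Lemma measurable_palm_moment : measurable_fun setT palm_moment.
Proof.
apply: (@measurable_fun_prob_integral _ _ _ _ _ palm mpalm
  (fun z => (conf_prod z.2 A)%:R%:E)) => [|z]; last by rewrite lee_fin.
apply/measurable_EFinP.
exact: (measurableT_comp (measurable_conf_prod properE cr mA bA) measurable_snd).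
Qed.

Lemma palm_moment_ge0 q : 0 <= palm_moment q.
Proof. by apply: integral_ge0 => X _; rewrite lee_fin. Qed.

(** The Palm formula is applied to the product of the indicator of [B] at [q]
    and of the counts of [X] in the [A i]. Since [B] does not meet the [A i],
    adding [q] to [X] does not change these counts; on the other side, the sum
    over the points of [X] is the product of the counts of [B] and the [A i],
    whose expectation is an integral of [rho]. *)
Lemma palm_momentE (B : set E) : measurable B -> B `<=` D ->
  (forall i, B `&` A i = set0) ->
  \int[mpow mu 1]_(q in @thead _ E @^-1` B) (palm_moment q * (rho1 q)%:E) =
  \int[mpow mu 1]_(q in @thead _ E @^-1` B) section_mass mu rho A q.
Proof.
move=> mB BD BA; have [mr r0 _ _] := rhoP.
have bB : metric_bounded B := metric_bounded_sub BD bD.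
transitivity (\int[P]_X (conf_prod X (consA B))%:R%:E); last first.
  rewrite (corr_box rhoP); last 3 first.
  - by move=> i; rewrite /cons_sets; case: unliftP.
  - by move=> i; rewrite /cons_sets; case: unliftP.
  - move=> i j _ _; rewrite /cons_sets; case: (unliftP ord0 i) => [i' ->|->];
      case: (unliftP ord0 j) => [j' ->|->]//; rewrite ?unlift_none ?liftK.
    + by move=> /(tA I I) ->.
    + by move=> -[x [xA xB]]; have : (B `&` A i') x by []; rewrite BA.
    + by move=> -[x [xB xA]]; have : (B `&` A j') x by []; rewrite BA.
  exact/esym/integral_section_mass.
pose u (z : conf E * 1.-tuple E) : R :=
  (\1_simple_on z.1 * ((thead z.2 \in B)%:R * (conf_prod z.1 A)%:R))%R.
have mS := measurable_simple_on.
have mI : measurable_fun setT (\1_simple_on : conf E -> R) by exact: measurable_indic.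
have mtB : measurable_fun setT (fun q : 1.-tuple E => (thead q \in B)%:R : R).
  rewrite (_ : (fun _ => _) = \1_B \o @thead _ E).
    by apply: measurableT_comp; [exact: measurable_indic|exact: measurable_thead].
  by apply/funext => z; rewrite /= indicE.
have mcA : measurable_fun setT (fun X : conf E => (conf_prod X A)%:R : R).
  exact: (measurable_conf_prod properE cr).
have mu_ : measurable_fun setT u.
  apply: measurable_funM; first exact: (measurableT_comp mI measurable_fst).
  apply: measurable_funM; first exact: (measurableT_comp mtB measurable_snd).
  exact: (measurableT_comp mcA measurable_fst).
have u0 z : (0 <= u z)%R by rewrite /u indicE !mulr_ge0.
have addA (q : 1.-tuple E) X : B (thead q) -> conf_prod (conf_add X q) A = conf_prod X A.
  move=> Bq; apply: eq_bigr => i _; rewrite conf_count_add// memNset ?addn0// => Aq.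
  by have : (B `&` A i) (thead q) by []; rewrite BA.
have uE (q : 1.-tuple E) X : u (conf_add X q, q) =
    (\1_[set z : 1.-tuple E * conf E | simple_on (conf_add z.2 z.1)] (q, X) *
     ((thead q \in B)%:R * (conf_prod X A)%:R))%R.
  have sE : (conf_add X q \in simple_on) =
      ((q, X) \in [set z : 1.-tuple E * conf E | simple_on (conf_add z.2 z.1)]).
    by apply/idP/idP => /set_mem h; exact/mem_set.
  rewrite /u /= !indicE sE; congr (_ * _)%R.
  case: (boolP (thead q \in B)) => [/set_mem Bq|_]; last by rewrite !mul0r.
  by rewrite addA.
have muj : measurable_fun setT (fun z : 1.-tuple E * conf E => u (conf_add z.2 z.1, z.1)).
  under eq_fun => z do rewrite uE.
  apply: measurable_funM.
    rewrite (_ : (fun _ => _) = \1_[set z : 1.-tuple E * conf E | simple_on (conf_add z.2 z.1)]).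
      by apply: measurable_indic; exact: measurable_simple_on_add.
    by apply/funext => -[].
  apply: measurable_funM; first exact: (measurableT_comp mtB measurable_fst).
  exact: (measurableT_comp mcA measurable_snd).
have mcc : measurable_fun setT (fun X : conf E => (conf_prod X (consA B))%:R : R).
  by apply: (measurable_conf_prod properE cr) => i; rewrite /cons_sets; case: unliftP.
transitivity (\int[P]_X (\esum_(q in [set q : 1.-tuple E |
      uniq q /\ forall i, mult X (tnth q i) != 0%N]) (u (X, q))%:E)); last first.
  transitivity (\int[P]_X (\1_simple_on X * (conf_prod X (consA B))%:R)%:E).
    apply: eq_integral => X _; case: (pselect (simple_on X)) => [sX|nsX].
      have [n sXn] := sX; rewrite indicE mem_set// mul1r conf_prod_cons.
      rewrite -(esum_points _ bD BD sXn).
      by apply: eq_esum => q _; rewrite /u /= indicE mem_set// mul1r.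
    rewrite indicE memNset// mul0r esum1// => q _.
    by rewrite /u /= indicE memNset// mul0r.
  apply: ge0_ae_eq_integral => //.
  - by apply/measurable_EFinP; apply: measurable_funM.
  - exact/measurable_EFinP.
  by apply: filterS P_simple => X sX _; rewrite indicE mem_set// mul1r.
rewrite (palm_formula mu_ u0 muj) integral_mkcond.
apply: ge0_ae_eq_integral => //.
have mtB' := @measurable_thead_preimage _ E 0 B mB.
have mrE : measurable_fun setT (fun q => (rho1 q)%:E) by exact/measurable_EFinP.
- apply/(measurable_restrictT _ _).1 => //; apply: measurable_funTS.
  by apply: emeasurable_funM => //; exact: measurable_palm_moment.
- apply: emeasurable_funM; last exact/measurable_EFinP.
  apply: (@measurable_fun_prob_integral _ _ _ _ _ palm mpalm
    (fun z => (u (conf_add z.2 z.1, z.1))%:E)) => //.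
    exact/measurable_EFinP.
  by move=> z; rewrite lee_fin.
- move=> q _; apply: erestrict_ge0 => {}q _.
  by rewrite mule_ge0 ?palm_moment_ge0// lee_fin.
- move=> q _; rewrite mule_ge0 ?lee_fin//.
  by apply: integral_ge0 => X _; rewrite lee_fin.
apply: filterS palm_simple_ae => q sq _; rewrite patchE.
have -> : (q \in @thead _ E @^-1` B) = (thead q \in B).
  by apply/idP/idP => /set_mem h; exact/mem_set.
case: (eqVneq (rho1 q) 0%R) => [->|rq]; first by rewrite !mule0; case: ifP.
have {}sq := sq (ltac:(by rewrite lt_neqAle eq_sym rq rho1_ge0)).
have -> : \int[palm q]_X (u (conf_add X q, q))%:E =
    \int[palm q]_X ((thead q \in B)%:R * (conf_prod X A)%:R)%:E.
  apply: ge0_ae_eq_integral => //.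
  - by apply/measurable_EFinP; exact: (measurableT_comp muj (pair1_measurable _)).
  - by apply/measurable_EFinP; apply: measurable_funM.
  - by move=> X _; rewrite lee_fin.
  - apply: filterS sq => X sX _; rewrite uE indicE mem_set ?mul1r//.
case: (thead q \in B); last by rewrite integral0_eq ?mul0e// => X _; rewrite mul0r.
by congr (_ * _); apply: eq_integral => X _; rewrite mul1r.
Qed.

End Moments.
End PalmMoments.

Section PalmMomentAe.
Context d (R : realType) (E : borelMetricType d R).
Hypothesis properE : forall B : set E, metric_bounded B -> precompact B.
Variables (c : nat -> E) (r : nat -> R).
Hypothesis cr : ball_base c r.
Variables (mu : {sigma_finite_measure set E -> \bar R}) (P : probability (conf E) R).
Variable rho1 : 1.-tuple E -> R.
Hypotheses (mrho1 : measurable_fun setT rho1) (rho1_ge0 : forall q, 0 <= rho1 q).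
Variable palm : 1.-tuple E -> probability (conf E) R.
Hypothesis palmP : reduced_palm mu P rho1 palm.
Variable D : set E.
Hypotheses (mD : measurable D) (bD : metric_bounded D).
Hypothesis P_simple : {ae P, forall X, simple_on c r D X}.
Variables (k : nat) (rho : k.+1.-tuple E -> R).
Hypothesis rhoP : correlation_function mu P rho.
Variable A : 'I_k -> set E.
Hypotheses (mA : forall i, measurable (A i)) (AD : forall i, A i `<=` D).
Hypothesis tA : trivIset setT A.
Local Open Scope ereal_scope.

(** By [palm_momentE], both sides have the same integral over every measurable
    subset of [C]. *)
Lemma palm_moment_ae (C : set E) : measurable C -> C `<=` D ->
  (forall i, C `&` A i = set0) ->
  {ae mpow mu 1, forall q, C (thead q) ->
    palm_moment palm A q * (rho1 q)%:E = section_mass mu rho A q}.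
Proof.
move=> mC CD CA; have [mr r0 _ _] := rhoP.
have bA i : metric_bounded (A i) by exact: (metric_bounded_sub (@AD i) bD).
have mtC := @measurable_thead_preimage _ E 0 C mC.
have ms := @measurable_section_mass _ _ _ mu _ _ mr r0 A mA.
have h : ae_eq (mpow mu 1) (@thead _ E @^-1` C) (section_mass mu rho A)
    (fun q => palm_moment palm A q * (rho1 q)%:E).
  apply: integral_ae_eq => //.
  - apply/integrableP; split; first exact: measurable_funTS.
    under eq_integral do rewrite gee0_abs ?section_mass_ge0//.
    rewrite integral_section_mass//.
    apply: le_lt_trans (corr_local_finite rhoP mD bD).
    apply: le_measure; rewrite ?inE//.
    + by apply: measurable_box => i; rewrite /cons_sets; case: unliftP.
    + exact: measurable_box.
    + move=> x xA i; have := xA i; rewrite /cons_sets.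
      by case: unliftP => [j _ /AD|_ /CD].
  - apply: measurable_funTS; apply: emeasurable_funM.
      exact: (measurable_palm_moment properE cr palmP).
    exact/measurable_EFinP.
  - move=> E' E'C mE'.
    rewrite (set_tuple1E E').
    rewrite (palm_momentE properE cr mrho1 rho1_ge0 palmP mD bD P_simple rhoP mA bA tA)//.
    + exact: measurable_set_tuple1.
    + by move=> x Bx; apply: CD; have := E'C [tuple x] Bx; rewrite /= theadE.
    + move=> i; apply/seteqP; split => // x [Bx Ax].
      have := E'C [tuple x] Bx; rewrite /= theadE => Cx.
      by have : (C `&` A i) x by []; rewrite CA.
by apply: filterS h => q hq Cq; rewrite hq.
Qed.

End PalmMomentAe.

(** * From cells to correlation functions *)

Section WeightedCount.
Context d (R : realType) (E : borelMetricType d R).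
Hypothesis properE : forall B : set E, metric_bounded B -> precompact B.
Variables (c : nat -> E) (r : nat -> R).
Hypothesis cr : ball_base c r.
Variable Q : probability (conf E) R.
Variable C : set E.
Hypotheses (mC : measurable C) (bC : metric_bounded C).
Variable w : conf E -> nat.
Hypothesis mw : measurable_fun setT (fun X => (w X)%:R : R).
Local Open Scope ereal_scope.

(** The expectation of a product of counts, as a function of one of the sets
    counted: [w] stands for the product of the other counts. *)
Definition weighted_count (A : set E) : \bar R :=
  \int[Q]_X (confm X (A `&` C) * (w X)%:R%:E).

Let wc0 : weighted_count set0 = 0.
Proof. by apply: integral0_eq => X _; rewrite set0I measure0 mul0e. Qed.

Let wc_ge0 A : 0 <= weighted_count A.
Proof. by apply: integral_ge0 => X _; rewrite mule_ge0 ?lee_fin. Qed.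

Let wc_sigma_additive : semi_sigma_additive weighted_count.
Proof.
move=> F mF tF mUF.
have -> : weighted_count (\bigcup_n F n) = \sum_(n <oo) weighted_count (F n).
  rewrite -integral_nneseries//; last 2 first.
  - move=> n; apply: emeasurable_funM; last exact/measurable_EFinP.
    apply: (measurable_confm properE cr); first exact: measurableI.
    by apply: metric_bounded_sub bC; exact: subIsetr.
  - by move=> n X _; rewrite mule_ge0 ?lee_fin.
  apply: eq_integral => X _; rewrite setI_bigcupl measure_bigcup//; last 2 first.
  - by move=> n _; exact: measurableI.
  - exact: trivIset_setIr.
  rewrite muleC -nneseriesZl//.
  rewrite [RHS](eq_eseriesr (g := fun n => (w X)%:R%:E * confm X (F n `&` C))).
    by apply: eq_eseriesl => n; rewrite in_setT.
  by move=> n _; rewrite muleC.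
by apply: is_cvg_ereal_nneg_natsum => n _; exact: wc_ge0.
Qed.

HB.instance Definition _ := isMeasure.Build _ _ _ weighted_count
  wc0 wc_ge0 wc_sigma_additive.

Lemma weighted_count_unique (m : {measure set E -> \bar R}) :
  (forall s, weighted_count (base_inter c r s) = m (base_inter c r s)) ->
  m setT < +oo -> forall A, measurable A -> weighted_count A = m A.
Proof.
move=> hb mT A mA.
apply: (measure_unique (base_inters c r) (fun=> setT)) => //.
- exact: base_interE.
- exact: setI_closed_base_inters.
- by move=> _; exists [::] => //; exact: base_inter_nil.
- by apply: bigcup_const; exists 0%N.
- by move=> _ [s _ <-]; exact: hb.
- move=> _; have h := hb [::]; rewrite base_inter_nil in h.
  by apply: le_lt_trans mT; rewrite -h.
Qed.

End WeightedCount.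

(** The sets [Cs], which will be distinct cells, make the sets [B i `&` Cs i]
    disjoint whatever the [B i] are, so that the [B i] can be varied
    independently. *)
Definition box_identity d (R : realType) (E : borelMetricType d R)
    (Q : probability (conf E) R) k (Cs : 'I_k -> set E)
    (lam : set (k.-tuple E) -> \bar R) (B : 'I_k -> set E) : Prop :=
  (\int[Q]_X (conf_prod X (fun i => B i `&` Cs i))%:R%:E =
   lam (box (fun i => B i `&` Cs i)))%E.

Section BoxExtension.
Context d (R : realType) (E : borelMetricType d R).
Hypothesis properE : forall B : set E, metric_bounded B -> precompact B.
Variables (c : nat -> E) (r : nat -> R).
Hypothesis cr : ball_base c r.
Variable Q : probability (conf E) R.
Variables (k : nat) (Cs : 'I_k -> set E).
Hypotheses (mC : forall i, measurable (Cs i)) (bC : forall i, metric_bounded (Cs i)).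
Variable lam : {measure set (k.-tuple E) -> \bar R}.
Local Open Scope ereal_scope.

Notation box_identity := (box_identity Q Cs lam).

Hypothesis lam_fin : lam (box Cs) < +oo.
Hypothesis base : forall t : 'I_k -> seq nat,
  box_identity (fun i => base_inter c r (t i)).

Let upd (B : 'I_k -> set E) i0 (A : set E) i := if i == i0 then A else B i.

Let bBC (B : 'I_k -> set E) i : metric_bounded (B i `&` Cs i).
Proof. by apply: metric_bounded_sub (bC i); exact: subIsetr. Qed.

Let step (B : 'I_k -> set E) i0 : (forall i, measurable (B i)) ->
  (forall s, box_identity (upd B i0 (base_inter c r s))) ->
  forall A, measurable A -> box_identity (upd B i0 A).
Proof.
move=> mB hb.
pose w (X : conf E) : nat := (\prod_(i | i != i0) conf_count X (B i `&` Cs i))%N.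
have mw : measurable_fun setT (fun X => (w X)%:R : R).
  rewrite /w; under eq_fun do rewrite natr_prod -big_filter.
  apply: measurable_prod => i _; apply: (measurable_conf_count properE cr) => //.
  exact: measurableI.
have cpE X A : (conf_prod X (fun i => upd B i0 A i `&` Cs i) =
    conf_count X (A `&` Cs i0) * w X)%N.
  rewrite /conf_prod (bigD1 i0)//= /upd eqxx; congr muln.
  by apply: eq_bigr => i /negbTE ->.
have wcE A : weighted_count Q (Cs i0) w A =
    \int[Q]_X (conf_prod X (fun i => upd B i0 A i `&` Cs i))%:R%:E.
  apply: eq_integral => X _; rewrite cpE natrM EFinM confmE//.
  by apply: metric_bounded_sub (bC i0); exact: subIsetr.
have mS : measurable (box (fun i => upd B i0 setT i `&` Cs i)).
  by apply: measurable_box => i; apply: measurableI => //; rewrite /upd; case: ifP.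
have mt : measurable_fun setT (fun p : k.-tuple E => tnth p i0) by exact: measurable_tnth.
have [m2 m2E] : exists m2 : {measure set E -> \bar R},
    forall A, m2 A = lam (box (fun i => upd B i0 A i `&` Cs i)).
  unshelve eexists (pushforward (mrestr lam mS) (fun p : k.-tuple E => tnth p i0)) => //.
  move=> A; rewrite /pushforward /mrestr /=; congr (lam _); apply/seteqP; split.
    move=> p [pA pS] i; have := pS i; rewrite /upd; case: eqP => [->|_//].
    by move=> [_ ?]; split.
  move=> p pA; split; first by have := pA i0; rewrite /upd eqxx => -[].
  by move=> i; have := pA i; rewrite /upd; case: eqP => // _ [_ ?]; split.
move=> A mA; rewrite /box_identity -wcE -m2E.
apply: (weighted_count_unique properE cr) => // [s|]; first by rewrite wcE m2E; exact: hb.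
rewrite m2E; apply: le_lt_trans lam_fin; apply: le_measure; rewrite ?inE//.
  exact: measurable_box.
by move=> p pA i; have [] := pA i.
Qed.

(** The coordinates are freed from the pi-system one at a time: as functions
    of one [B i], both sides are finite measures. *)
Lemma box_identity_ext (B : 'I_k -> set E) :
  (forall i, measurable (B i)) -> box_identity B.
Proof.
suff h n : forall B : 'I_k -> set E, (forall i, measurable (B i)) ->
    (forall i : 'I_k, (n <= i)%N -> base_inters c r (B i)) -> box_identity B.
  by move=> mB; apply: (h k) => // i; rewrite leqNgt ltn_ord.
elim: n => [|n IHn] {}B mB bB.
  have /choice[t tB] : forall i : 'I_k, exists s, base_inter c r s = B i.
    by move=> i; have [s _ sB] := bB i (leq0n _); exists s.
  by have := base t; rewrite (_ : (fun i => _) = B)//; apply/funext.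
case: (ltnP n k) => nk; last first.
  by apply: IHn => // i ni; have := leq_ltn_trans (leq_trans nk ni) (ltn_ord i); rewrite ltnn.
pose i0 := Ordinal nk.
have -> : B = upd B i0 (B i0).
  by apply/funext => i; rewrite /upd; case: eqP => // ->.
apply: step => // s; apply: IHn => i.
  by rewrite /upd; case: ifP => // _; exact: measurable_base_inter.
rewrite /upd; case: eqP => [_ _|ii0 ni]; first by exists s.
apply: bB; rewrite ltn_neqAle ni andbT; apply: contra_notN ii0 => /eqP ii.
exact: val_inj.
Qed.

End BoxExtension.

Section CorrelationFromCells.
Context d (R : realType) (E : borelMetricType d R).
Hypothesis properE : forall B : set E, metric_bounded B -> precompact B.
Variables (c : nat -> E) (r : nat -> R).
Hypothesis cr : ball_base c r.
Notation code := (ball_code c r).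
Notation cell := (ball_cell c r).
Variables (mu : {sigma_finite_measure set E -> \bar R}) (Q : probability (conf E) R).
Variables (x0 q : E) (k : nat) (g : k.-tuple E -> R).
Hypotheses (mg : measurable_fun setT g) (g0 : forall p, 0 <= g p).
Notation D m := (ball x0 (m%:R : R)).
Local Open Scope ereal_scope.
Notation lam := (density_measure (mpow mu k) g).

Hypothesis Q_simple : forall m : nat, D m q ->
  {ae Q, forall X, exists n, cell_simple c r [:: q] (D m) n X}.
Hypothesis Q_cells : forall (m n : nat) (b : k.-tuple (n.-tuple bool))
    (t : 'I_k -> seq nat), D m q -> uniq b ->
  all (fun x => x \notin map (code n) [:: q]) b ->
  box_identity Q (fun i => D m `&` cell n (tnth b i)) lam
    (fun i => base_inter c r (t i)).
Hypothesis lam_fin : forall m, D m q -> lam (box (fun=> D m)) < +oo.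
Hypothesis g_uniq : {ae mpow mu k, forall p, g p <> 0%R ->
  uniq p && all (fun y => y \notin [:: q]) p}.

(** The identities on cells extend from the pi-system to Borel sets, and
    [factorial_moment] turns them into the factorial moments of [Q]. These are
    integrals over the tuples without repetition that avoid [q], and by
    [g_uniq] the other tuples do not count. *)
Lemma correlation_from_cells : correlation_function mu Q g.
Proof.
have mD m : measurable (D m) := measurable_mball _ _.
have bD m : metric_bounded (D m) := bounded_mball _ _.
have large (B : set E) : metric_bounded B -> exists m : nat, B `<=` D m /\ D m q.
  move=> /(bounded_center x0)[m Bm]; have [m' qm'] := mball_nat_cover x0 q.
  exists (maxn m m'); split.
    exact: subset_trans Bm (mball_nat_mono (leq_maxl _ _)).
  exact: mball_nat_mono (leq_maxr m m') _ qm'.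
split => //.
- move=> B mB bB; have [m [Bm qm]] := large B bB.
  apply/integrableP; split; first by apply/measurable_EFinP; exact: measurable_funTS.
  under eq_integral do rewrite gee0_abs ?lee_fin//.
  apply: le_lt_trans (lam_fin qm); rewrite /density_measure.
  apply: ge0_subset_integral => //.
  + exact: (@measurable_box _ _ _ _ (fun=> B)).
  + exact: measurable_box.
  + by apply/measurable_EFinP; exact: measurable_funTS.
  + by move=> x _; rewrite lee_fin.
  + by move=> x xB i; exact: Bm.
move=> j A l mA bA tA l0 lk.
have [s sl ->] := power_box_label E lk.
have [m [AD qm]] : exists m : nat, (forall a, A a `<=` D m) /\ D m q.
  have /choice[h hA] : forall a : 'I_j, exists m : nat, A a `<=` D m /\ D m q.
    by move=> a; exact: large.
  have [m' qm'] := mball_nat_cover x0 q.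
  exists (maxn m' (\max_a h a)); split.
    move=> a; apply: subset_trans (hA a).1 (mball_nat_mono _).
    by rewrite leq_max leq_bigmax orbT.
  exact: mball_nat_mono (leq_maxl _ _) _ qm'.
have Qb n (b : k.-tuple (n.-tuple bool)) : uniq b ->
    all (fun x => x \notin map (code n) [:: q]) b ->
    \int[Q]_X (conf_prod X (fun i => A (tnth s i) `&` cell n (tnth b i)))%:R%:E =
    lam (box (fun i => A (tnth s i) `&` cell n (tnth b i))).
  move=> ub qb.
  have mDc i : measurable (D m `&` cell n (tnth b i)).
    by apply: measurableI => //; exact: measurable_cell.
  have := @box_identity_ext _ _ _ properE _ _ cr Q k
    (fun i => D m `&` cell n (tnth b i)) mDc _ lam _ _ (fun i => A (tnth s i)) _.
  have AE : (fun i => A (tnth s i) `&` (D m `&` cell n (tnth b i))) =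
      (fun i => A (tnth s i) `&` cell n (tnth b i)).
    by apply/funext => i; rewrite setIA (setIidl (AD _)).
  rewrite /box_identity AE; apply => //.
  - by move=> i; apply: metric_bounded_sub (bD m); exact: subIsetl.
  - apply: le_lt_trans (lam_fin qm); apply: le_measure; rewrite ?inE//.
    + exact: measurable_box.
    + exact: measurable_box.
    + by move=> p pD i; have [] := pD i.
  - by move=> t; exact: Q_cells.
have := @factorial_moment _ _ _ properE _ _ cr Q (D m) (bD m) 'I_j A mA AD tA k s
  [:: q] lam (Q_simple qm).
move=> /(_ mg g0 Qb).
under eq_integral => X _ do under eq_bigr => a _ do rewrite sl.
move=> ->; rewrite /density_measure.
have mbox : measurable (box (fun i => A (tnth s i))) by exact: measurable_box.
have mgE : measurable_fun setT (fun p => (g p)%:E) by exact/measurable_EFinP.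
pose U : set (k.-tuple E) :=
  [set x : k.-tuple E | uniq x && all (fun y => y \notin [:: q]) x].
rewrite -[RHS]/(\int[mpow mu k]_(x in box (fun i => A (tnth s i)) `&` U) (g x)%:E).
have mU : measurable U by exact: (measurable_uniq_tuple cr).
rewrite [LHS]integral_mkcond [RHS]integral_mkcond.
apply: ge0_ae_eq_integral => //.
- by apply/(measurable_restrictT _ _).1 => //; exact: measurable_funTS.
- apply/(measurable_restrictT _ _).1; first exact: measurableI.
  exact: measurable_funTS.
- by move=> x _; apply: erestrict_ge0 => {}x _; rewrite lee_fin.
- by move=> x _; apply: erestrict_ge0 => {}x _; rewrite lee_fin.
apply: filterS g_uniq => p gp _; rewrite !patchE in_setI.
case: (p \in box _) => //=; case: ifPn => // /negP pU.
case: (eqVneq (g p) 0%R) => [->//|/eqP/gp up].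
by case: pU; exact: mem_set.
Qed.

End CorrelationFromCells.

(** * Palm measures of Pfaffian processes *)

Lemma qdet2 (C : comNzRingType) (M : 'M[quat C]_2) :
  qdet ord0 M = M ord0 ord0 * M ord_max ord_max - M ord0 ord_max * M ord_max ord0.
Proof.
rewrite /= !big_ord_recl big_ord0 addr0 /= !mxE !(ord1 (odflt _ _)) /=.
have -> : lift ord0 ord0 = ord_max :> 'I_2 by exact: val_inj.
by rewrite /= expr0 mul1r expr1 mulN1r.
Qed.

Lemma ae_forall_countable d (T : measurableType d) (R : realType)
    (m : {measure set T -> \bar R}) (I : countType) (Phi : I -> T -> Prop) :
  (forall i, {ae m, forall x, Phi i x}) -> {ae m, forall x, forall i, Phi i x}.
Proof.
move=> h.
have h' n : {ae m, forall x, if unpickle n is Some i then Phi i x else True}.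
  by case: (unpickle n) => [i|]; [exact: h|exact: aeW].
by apply: filterS (ae_foralln h') => x hx i; have := hx (pickle i); rewrite pickleK.
Qed.

Section PalmKernelAlgebra.
Context d (R : realType) (E : borelMetricType d R).
Variables (K : E -> E -> quat R[i]) (x0 : E) (a : R).
Hypothesis Kadj : selfadjoint_kernel K.
Hypotheses (Kaa : K x0 x0 = (a%:C)%C%:A) (a0 : a != 0).

Lemma palm_kernelE x y :
  palm_kernel K x0 x y = K x y - (q0 (K x0 x0))^-1 *: (K x x0 * K x0 y).
Proof.
rewrite /palm_kernel qdet2 !mxE /= scalerBr; congr (_ - _).
rewrite Kaa q0_scalar mulr_algr scalerA mulVf ?scale1r//.
by rewrite (fmorph_eq0 (real_complex R)).
Qed.

Lemma palm_kernel_adj : selfadjoint_kernel (palm_kernel K x0).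
Proof.
by move=> x y; rewrite !palm_kernelE quat_adjB quat_adjZ quat_adjM -!Kadj.
Qed.

Lemma qdet_palm_kernel n (p : n.+1.-tuple E) :
  qdet ord0 (\matrix_(i, j) palm_kernel K x0 (tnth p i) (tnth p j)) =
  ((a%:C)%C)^-1 *: qdet ord0 (\matrix_(i < n.+2, j < n.+2)
     K (tnth (consp (x0, p)) i) (tnth (consp (x0, p)) j)).
Proof.
have C2 : 2%:R != 0 :> R[i] by rewrite pnatr_eq0.
rewrite -(@qdet_schur _ _ K n (fun i => tnth (consp (x0, p)) i))//.
  congr (qdet _ _); apply/matrixP => i j; rewrite !mxE palm_kernelE !tnthS.
  by rewrite Kaa q0_scalar.
by rewrite (fmorph_eq0 (real_complex R)).
Qed.

End PalmKernelAlgebra.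

Section PalmCorrelation.
Context d (R : realType) (E : borelMetricType d R).
Hypothesis properE : forall B : set E, metric_bounded B -> precompact B.
Variables (c : nat -> E) (r : nat -> R).
Hypothesis cr : ball_base c r.
Notation code := (ball_code c r).
Notation cell := (ball_cell c r).
Variables (mu : {sigma_finite_measure set E -> \bar R}) (P : probability (conf E) R).
Variable x0 : E.
Notation D m := (ball x0 (m%:R : R)).
Local Open Scope ereal_scope.

(** Local integrability makes the integrals over bounded sets finite, so that
    they determine the function. *)
Lemma correlation1_unique (f g : 1.-tuple E -> R) :
  correlation_function mu P f -> correlation_function mu P g ->
  {ae mpow mu 1, forall q, f q = g q}.
Proof.
move=> fP gP; have [mf f0 If _] := fP; have [mg g0 _ _] := gP.
have h (m : nat) : {ae mpow mu 1, forall q, D m (thead q) -> f q = g q}.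
  have mD : measurable (D m) := measurable_mball _ _.
  have bD : metric_bounded (D m) := bounded_mball _ _.
  have boxE (B : set E) : box (fun _ : 'I_1 => B) = @thead _ E @^-1` B.
    by apply/seteqP; split => x xB; [exact: (xB ord0)|move=> i; rewrite (ord1 i)].
  have : ae_eq (mpow mu 1) (box (fun=> D m)) (EFin \o f) (EFin \o g).
    apply: integral_ae_eq => //.
    - exact: measurable_box.
    - exact: If.
    - by apply/measurable_EFinP; exact: measurable_funTS.
    move=> E' E'D mE'; pose B := [set x | E' [tuple x]].
    have E'E : E' = box (fun=> B) by rewrite boxE; exact: set_tuple1E.
    have mB : measurable B := measurable_set_tuple1 mE'.
    have bB : metric_bounded B.
      apply: metric_bounded_sub bD => x Bx; have := E'D [tuple x] Bx.
      by move=> /(_ ord0); rewrite (tnth_nth x).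
    rewrite E'E -[LHS]/(density_measure (mpow mu 1) f (box (fun=> B))).
    rewrite -[RHS]/(density_measure (mpow mu 1) g (box (fun=> B))).
    by rewrite -(corr_power fP)// (corr_power gP).
  apply: filterS => q hq Dq; apply: EFin_inj; apply: hq.
  by move=> i; rewrite (ord1 i).
apply: filterS (ae_foralln h) => q hq.
by have [m qm] := mball_nat_cover x0 (thead q); exact: hq qm.
Qed.

Variable rho1 : 1.-tuple E -> R.
Hypotheses (mrho1 : measurable_fun setT rho1) (rho1_ge0 : forall q, (0 <= rho1 q)%R).
Variable palm : 1.-tuple E -> probability (conf E) R.
Hypothesis palmP : reduced_palm mu P rho1 palm.
Hypothesis P_simple : forall m : nat, {ae P, forall X, simple_on c r (D m) X}.
Variables (k : nat) (rho : k.+1.-tuple E -> R).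
Hypothesis rhoP : correlation_function mu P rho.

Lemma section_mass_fin_ae (m : nat) : {ae mpow mu 1, forall q, D m (thead q) ->
  section_mass mu rho (fun=> D m) q < +oo}.
Proof.
have [mr r0 _ _] := rhoP.
have mD : measurable (D m) := measurable_mball _ _.
have bD : metric_bounded (D m) := bounded_mball _ _.
have mtD := @measurable_thead_preimage _ E 0 _ mD.
have : (mpow mu 1).-integrable (@thead _ E @^-1` D m) (section_mass mu rho (fun=> D m)).
  apply/integrableP; split.
    by apply: measurable_funTS; exact: measurable_section_mass.
  under eq_integral do rewrite gee0_abs ?section_mass_ge0//.
  rewrite integral_section_mass//.
  apply: le_lt_trans (corr_local_finite rhoP mD bD).
  apply: le_measure; rewrite ?inE//.
  + by apply: measurable_box => i; rewrite /cons_sets; case: unliftP.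
  + exact: measurable_box.
  + by move=> x xA i; have := xA i; rewrite /cons_sets; case: unliftP.
move=> /(integrable_ae mtD); apply: filterS => q hq Dq.
by rewrite ltey_eq hq.
Qed.

(** [palm_moment_ae] holds outside a null set of [q] that depends on the sets.
    It is used for countably many of them only: cells of the balls [D m],
    given by their codes [b], cut by the intersections of base balls listed in
    [t]. *)
Lemma palm_correlation_ae : {ae mpow mu 1, forall q, (0 < rho1 q)%R ->
  correlation_function mu (palm q)
    (fun p : k.-tuple E => rho (consp (thead q, p)) / rho1 q)%R}.
Proof.
have [mr r0 _ _] := rhoP.
have mD m : measurable (D m) := measurable_mball _ _.
have bD m : metric_bounded (D m) := bounded_mball _ _.
have H1 : {ae mpow mu 1, forall q, forall m : nat, (0 < rho1 q)%R ->
    {ae palm q, forall X, simple_on c r (D m) (conf_add X q)}}.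
  apply: ae_foralln => m.
  exact: (palm_simple_ae properE cr mrho1 rho1_ge0 palmP (mD m) (bD m) (P_simple m)).
pose A (m n : nat) (b : k.-tuple (n.-tuple bool)) (t : k.-tuple (seq nat)) i :=
  base_inter c r (tnth t i) `&` (D m `&` cell n (tnth b i)).
have H2 : {ae mpow mu 1, forall q, forall (m n : nat) (b : k.-tuple (n.-tuple bool))
    (t : k.-tuple (seq nat)), uniq b -> code n (thead q) \notin b -> D m (thead q) ->
    palm_moment palm (A m n b t) q * (rho1 q)%:E = section_mass mu rho (A m n b t) q}.
  apply: ae_foralln => m; apply: ae_foralln => n.
  apply: ae_forall_countable => b; apply: ae_forall_countable => t.
  case: (boolP (uniq b)) => [ub|_]; last exact: aeW.
  pose C := D m `&` ~` \bigcup_(i in [set: 'I_k]) cell n (tnth b i).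
  have mC : measurable C.
    apply: measurableI => //; apply: measurableC; apply: fin_bigcup_measurable => [|i _].
      exact: finite_finset.
    exact: measurable_cell.
  have mA i : measurable (A m n b t i).
    apply: measurableI; first exact: measurable_base_inter.
    by apply: measurableI => //; exact: measurable_cell.
  have AD i : A m n b t i `<=` D m by move=> x [_ []].
  have tA : trivIset setT (A m n b t).
    have := @cells_trivIset _ _ _ c r n k
      (fun i => base_inter c r (tnth t i) `&` D m) b ub.
    by congr (trivIset _ _); apply/funext => i; rewrite /A setIA.
  have CA i : C `&` A m n b t i = set0.
    by apply/seteqP; split => // x [[_ nx] [_ [_ xb]]]; apply: nx; exists i.
  have := palm_moment_ae properE cr mrho1 rho1_ge0 palmP (mD m) (bD m) (P_simple m)
    rhoP mA AD tA mC (@subIsetl _ _ _) CA.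
  apply: filterS => q hq _ qb Dq; apply: hq; split => // -[i _ qi].
  by move/negP: qb; apply; rewrite qi; exact: mem_tnth.
have H3 := ae_foralln section_mass_fin_ae.
have H4 := ae_mpow_split (corr_uniq properE cr (x0 := x0) (ltn0Sn k) rhoP P_simple).
apply: filterS (filterI (filterI H1 H2) (filterI H3 H4)) => q [[h1 h2] [h3 h4]] rq.
set g := fun p : k.-tuple E => _.
have mg : measurable_fun setT g.
  apply: measurable_funM => //.
  exact: (measurableT_comp mr (measurable_consp_section q)).
have g0 p : (0 <= g p)%R by rewrite divr_ge0// ltW.
have gE (S : set (k.-tuple E)) : measurable S ->
    density_measure (mpow mu k) g S * (rho1 q)%:E =
    \int[mpow mu k]_(p in S) (rho (consp (thead q, p)))%:E.
  move=> mS; rewrite /density_measure -ge0_integralZr//; last 3 first.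
  - by apply/measurable_EFinP; exact: measurable_funTS.
  - by move=> p _; rewrite lee_fin.
  - by rewrite lee_fin ltW.
  by apply: eq_integral => p _; rewrite -EFinM divfK ?gt_eqF.
apply: (@correlation_from_cells _ _ _ properE _ _ cr mu (palm q) x0 (thead q) k g mg g0).
- move=> m qm; apply: filterS (h1 m rq) => X [n sX]; exists n => b.
  have := sX b; rewrite conf_count_add//; last first.
    by apply: metric_bounded_sub (bD m); exact: subIsetl.
  rewrite /= inE; case: eqVneq => [->|_]; last by apply: leq_trans; rewrite leq_addr.
  by rewrite mem_set// addn1.
- move=> m n b t qm ub qb.
  have qb' : code n (thead q) \notin b.
    by apply/negP => /(allP qb); rewrite /= inE eqxx.
  have mbox : measurable (box (A m n b (mktuple t))).
    apply: measurable_box => i; apply: measurableI; first exact: measurable_base_inter.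
    by apply: measurableI => //; exact: measurable_cell.
  have := h2 m n b (mktuple t) ub qb' qm; rewrite /section_mass -gE//.
  have AE : A m n b (mktuple t) =
      (fun i => base_inter c r (t i) `&` (D m `&` cell n (tnth b i))).
    by apply/funext => i; rewrite /A tnth_mktuple.
  rewrite /palm_moment AE => /(congr1 (fun y => y * (rho1 q)^-1%:E)).
  by rewrite -!muleA -EFinM mulfV ?gt_eqF// !mule1.
- move=> m qm.
  have := h3 m qm; rewrite /section_mass -gE//; last exact: measurable_box.
  apply: contraTT; rewrite -!leNgt !leye_eq => /eqP ->.
  by rewrite gt0_mulye ?lte_fin.
- apply: filterS h4 => p hp gp.
  have : rho (consp (thead q, p)) <> 0%R.
    by move=> r00; apply: gp; rewrite /g r00 mul0r.
  move=> /hp /= /andP[qp ->] /=; apply/allP => y yp.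
  by rewrite inE; apply: contraNneq qp => <-.
Qed.

End PalmCorrelation.

Lemma quat_real_inj (R : realType) (a b : R) :
  ((a%:C)%C%:A : quat R[i]) = (b%:C)%C%:A -> a = b.
Proof. by move=> /(congr1 (@q0 _)); rewrite !q0_scalar => -[]. Qed.

Theorem theorem1p1 (d : measure_display) (R : realType)
    (E : borelMetricType d R)
    (locally_compactE : locally_compact [set: E])
    (sigma_compactE : sigma_compact E)
    (polishE : polish E)
    (properE : forall B : set E, metric_bounded B -> precompact B)
    (mu : {sigma_finite_measure set E -> \bar R})
    (radon_mu : radon mu)
    (P : probability (conf E) R)
    (K : E -> E -> quat R[i])
    (pfaffianP : pfaffian_process mu P K)
    (rho1 : 1.-tuple E -> R)
    (rho1P : correlation_function mu P rho1) :
  {ae correlation_measure mu rho1, forall q : 1.-tuple E,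
     let x0 := thead q in
     (exists2 c : R, 0 < c & K x0 x0 = (c%:C)%C%:A) /\
     (forall x y : E,
        almost_selfadjoint_mx ord0 (palm_matrix K x0 x y) /\
        palm_kernel K x0 x y =
          K x y - (q0 (K x0 x0))^-1 *: (K x x0 * K x0 y))} /\
  (forall palm : 1.-tuple E -> probability (conf E) R,
     reduced_palm mu P rho1 palm ->
     {ae correlation_measure mu rho1, forall q : 1.-tuple E,
        pfaffian_process mu (palm q) (palm_kernel K (thead q))}).
Proof.
have [mrho1 rho1_ge0 _ _] := rho1P.
have [Kadj Kcorr] := pfaffianP.
have density_ae (Phi : 1.-tuple E -> Prop) :
    {ae mpow mu 1, forall q, 0 < rho1 q -> Phi q} ->
    {ae correlation_measure mu rho1, forall q, Phi q} := ae_density mrho1 rho1_ge0.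
case: (pselect (exists x : E, True)) => [[x0 _]|Eempty]; last first.
  split=> [|palm _]; apply: density_ae; apply: aeW => q _;
    by case: Eempty; exists (thead q).
have [c [r cr]] := ex_ball_base x0 polishE.
pose rhos k := s2val (cid2 (Kcorr k)).
have rhosP k : correlation_function mu P (rhos k) := s2valP (cid2 (Kcorr k)).
have rhos_qdet k : {ae mpow mu k.+1, forall x, ((rhos k x)%:C)%C%:A =
    qdet ord0 (\matrix_(i, j) K (tnth x i) (tnth x j))} := s2valP' (cid2 (Kcorr k)).
have Kdiag : {ae mpow mu 1, forall q, K (thead q) (thead q) = ((rho1 q)%:C)%C%:A}.
  have h := correlation1_unique x0 rho1P (rhosP 0%N).
  by apply: filterS (filterI h (rhos_qdet 0%N)) => q [-> ->]; rewrite /= mxE.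
split.
  apply: density_ae; apply: filterS Kdiag => q Kq rq.
  split; first by exists (rho1 q).
  move=> x y; split; last by rewrite (palm_kernelE Kq)// gt_eqF.
  move=> i j i0 j0; rewrite !mxE (negbTE i0) (negbTE j0); exact: Kadj.
move=> palm palmP.
have P_simple (m : nat) : {ae P, forall X, simple_on c r (ball x0 (m%:R : R)) X}.
  (* At two equal points, the [2 x 2] quaternion determinant vanishes. *)
  apply: (cell_simple_ae properE cr (rhosP 1%N)) => //.
  - apply: filterS (rhos_qdet 1%N) => x; rewrite qdet2 !mxE => xE x01.
    by apply: quat_real_inj; rewrite xE x01 subrr scale0r.
  - exact: measurable_mball.
  - exact: bounded_mball.
have corr_ae := ae_foralln (fun k => palm_correlation_ae properE cr mrho1 rho1_ge0
  palmP P_simple (rhosP k.+1)).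
have qdet_ae := ae_foralln (fun k => ae_mpow_split (rhos_qdet k.+1)).
apply: density_ae.
apply: filterS (filterI Kdiag (filterI corr_ae qdet_ae)) => q [Kq [hcorr hqdet]] rq.
have rq0 : rho1 q != 0 by rewrite gt_eqF.
split; first exact: palm_kernel_adj Kadj Kq rq0.
move=> k; exists (fun p => rhos k.+1 (consp (thead q, p)) / rho1 q).
  exact: hcorr.
apply: filterS (hqdet k) => p; rewrite (qdet_palm_kernel Kadj Kq rq0) => <-.
by rewrite scalerA mulrC rmorphM fmorphV.
Qed.
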